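(* Let $D>0$ be the solution of $D^{2\alpha+2}=\sum_{j=1}^m(n_j^2\varepsilon_j^2)\wedge(n_jD)$, take $L=(l_0+1)\vee\lceil\log_2(D)\rceil$ and set $\tau=C_{\alpha,R}+\sqrt{(2\alpha+1)L}$. Then the $L_2$-risk of the distributed $(\boldsymbol\varepsilon,\boldsymbol\delta)$-differentially private protocol $\hat f_{L,\tau}$ (defined in the context) satisfies $$\sup_{f\in\mathcal B^{\alpha,R}_{p,q}}\mathbb E_f\left\|\hat f_{L,\tau}-f\right\|_2^2\le C_\psi\log(N)\,2^{-2L\alpha}\log(2/\delta'),$$ where $\delta'=\min_{i\in[m]}\delta_i$ and $C_\psi$ denotes a constant depending on the wavelet $\psi$.
   Context: Data. There are $m$ servers; server $j$ holds $n_j$ observations $Z^{(j)}=(Z^{(j)}_i)_{i=1}^{n_j}$, $Z_i^{(j)}=(Y_i^{(j)},X_i^{(j)})\in\mathcal Z=\mathbb R\times[0,1]$. All $N=\sum_{j=1}^m n_j$ observations are i.i.d. from $P_f$, under which $X_i^{(j)}\sim U[0,1]$, $Y_i^{(j)}=f(X_i^{(j)})+\xi_i^{(j)}$, with $\xi_i^{(j)}\sim N(0,1)$ independent of $X_i^{(j)}$. Privacy. A randomized transcript $T^{(j)}$ with conditional law $\mathbb P(\cdot\mid Z^{(j)})$ on $(\mathcal T,\mathscr T)$ is $(\varepsilon_j,\delta_j)$-differentially private if $\mathbb P(T^{(j)}\in A\mid Z^{(j)}=z)\le e^{\varepsilon_j}\mathbb P(T^{(j)}\in A\mid Z^{(j)}=z')+\delta_j$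 for all $A\in\mathscr T$ and all $z,z'\in\mathcal Z^{n_j}$ differing in at most one of their $n_j$ entries. A distributed $(\boldsymbol\varepsilon,\boldsymbol\delta)$-DP protocol consists of transcripts $T^{(j)}$, each depending only on the local data $Z^{(j)}$ and being $(\varepsilon_j,\delta_j)$-differentially private, and an estimator that is a function of $(T^{(1)},\dots,T^{(m)})$. $0<\varepsilon_j\le C_\varepsilon$ for a fixed constant $C_\varepsilon$. $\mathbb E_f$ is expectation over data from $P_f$ and the transcripts. The asymptotic regime is $N\to\infty$. Function class. $p\ge2$, $q\ge1$, $\alpha-1/p>1/2$, and $R>0$ is a constant. Let $\{\psi_{lk}\}$, $l\ge l_0$, be a Cohen–Daubechies–Vial compactly supported $A$-regular orthonormal wavelet basis of $L_2[0,1]$ with $A>\alpha$ (level $l_0$ denotes the father wavelets; levels $l>l_0$ contain $2^l$ wavelets, $k=0,\dots,2^l-1$, with $\psi_{lk}(x)=2^{l/2}\psi(2^lx-k)$ away from the boundary), and $f_{lk}=\langle f,\psi_{lk}\rangle$. Then $\|f\|_{\mathcal B^\alpha_{p,q}}=\big(\sum_{l\ge l_0}(2^{l(\alpha+1/2-1/p)}\|(f_{lk})_k\|_p)^q\big)^{1/q}$ (supremum over $l$ if $q=\infty$), and $\mathcal B^{\alpha,R}_{p,q}=\{f\in L_2[0,1]:\|f\|_{\mathcal B^\alpha_{p,q}}\le R\}$. $C_{\alpha,R}>0$ is a constant with $\|f\|_\infty\le C_{\alpha,R}$ for all $f\in\mathcal B^{\alpha,R}_{p,q}$. The constant $c_A$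 bounds, at each level $l$, the number of basis functions $\psi_{lk}$ with overlapping support (i.e. whose support contains a given point). The protocol. For $x\in\mathbb R$, $[x]_\tau=\max(-\tau,\min(x,\tau))$. For $l_0\le l\le L$ and all $k$ at level $l$, server $j$ computes $\hat f^{(j)}_{lk;\tau}=\frac1{n_j}\sum_{i=1}^{n_j}[Y_i^{(j)}]_\tau\psi_{lk}(X_i^{(j)})$ and outputs the transcript $T^{(j)}_{L,\tau}=\{T^{(j)}_{lk;\tau}\}_{l,k}$, $T^{(j)}_{lk;\tau}=\hat f^{(j)}_{lk;\tau}+W^{(j)}_{lk}$, with $W^{(j)}_{lk}$ independent $N\big(0,\,4\tau^2 2^Lc_\psi^2\log(2/\delta_j)/(n_j^2\varepsilon_j^2)\big)$ (also independent of the data), $c_\psi=2\sqrt2\sqrt{c_A}\|\psi\|_\infty$. The estimator is $$\hat f_{L,\tau}(x)=\sum_{l=l_0}^L\sum_k\Big(\sum_{j=1}^m u_jT^{(j)}_{lk;\tau}\Big)\psi_{lk}(x),\qquad u_j=\frac{v_j}{\sum_{j'}v_{j'}},\quad v_j=(n_j^2\varepsilon_j^2)\wedge(n_j2^L).$$ $a\wedge b=\min(a,b)$, $a\vee b=\max(a,b)$, $[m]=\{1,\dots,m\}$.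
   Formalization: D is assumed at least a fixed d0>0 (C_psi may depend on d0), since the bound fails as D tends to 0; delta_j<=1, N>=2. Privacy is proved when eps_j<=2log(2/delta_j) and every psi_lk, edge and father ones included, is at most 2^{l/2}||psi||_inf; the risk bound needs neither condition. *)

(* Defs.v *)
From HB Require Import structures.
From mathcomp Require Import all_boot all_order all_algebra.
From mathcomp Require Import all_classical all_reals all_analysis.
Set Implicit Arguments.
Unset Strict Implicit.
Unset Printing Implicit Defensive.
Import Order.TTheory GRing.Theory Num.Def Num.Theory.
Import numFieldNormedType.Exports.
Local Open Scope classical_set_scope.
Local Open Scope ring_scope.

(* A function on [0,1] is represented by a function on the whole line whose
   values outside [0,1] are irrelevant. *)

Definition unit_itv (R : realType) : set R := [set` `[0 : R, 1]].

Definition inner01 (R : realType) (f g : R -> R) : R :=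
  \int[lebesgue_measure]_(x in @unit_itv R) (f x * g x).

Definition sq_dist01 (R : realType) (f g : R -> R) : \bar R :=
  (\int[lebesgue_measure]_(x in @unit_itv R) ((f x - g x) ^+ 2)%:E)%E.

Definition L2_01 (R : realType) : set (R -> R) :=
  [set f : R -> R | measurable_fun (@unit_itv R) f /\
     (sq_dist01 f (fun=> 0%R) < +oo)%E].

Definition classC (R : realType) (A : nat) (f : R -> R) : Prop :=
  (forall i, (i < A)%N -> forall x, derivable (derive1n i f) x 1) /\
  (forall i, (i <= A)%N -> continuous (derive1n i f)).

(* Compactly supported A-regular orthonormal wavelet bases of L_2[0,1] of
   Cohen-Daubechies-Vial type.  Level l0 carries the father wavelets; level
   l > l0 carries 2^l wavelets, namely dilated translates of the mother wavelet
   in the interior, and dilates of finitely many fixed functions at the left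
   and at the right end of the interval.  A-regularity is: A continuous
   derivatives and A vanishing moments.  The number of father wavelets is left
   free, so that it does not depend on how the scaling levels are indexed. *)
Record cdv_basis (R : realType) (A : nat) := CDVBasis {
  lev0 : nat ;
  nfather : nat ;
  wave : nat -> nat -> R -> R ;   (* wave l k = psi_lk *)
  mother : R -> R ;
  bdry : nat ;                    (* boundary wavelets at each end *)
  bleft : nat -> R -> R ;
  bright : nat -> R -> R ;
  radius : R ;
  cA : R ;
  nwave := fun l : nat =>
    (if (l < lev0)%N then 0 else if l == lev0 then nfather else 2 ^ l)%N ;
  wsupp := fun l k =>
    closure [set x | @unit_itv R x /\ wave l k x != 0] ;
  wave_interior : forall l k x, (lev0 < l)%N ->
    (bdry <= k)%N -> (k + bdry < 2 ^ l)%N -> @unit_itv R x ->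
    wave l k x = 2 `^ (l%:R / 2) * mother (2 ^+ l * x - k%:R) ;
  wave_left : forall l k x, (lev0 < l)%N -> (k < bdry)%N -> @unit_itv R x ->
    wave l k x = 2 `^ (l%:R / 2) * bleft k (2 ^+ l * x) ;
  wave_right : forall l k x, (lev0 < l)%N -> (k < bdry)%N -> @unit_itv R x ->
    wave l (2 ^ l - k.+1)%N x
      = 2 `^ (l%:R / 2) * bright k (2 ^+ l * (1 - x)) ;
  bdry_small : (2 * bdry <= 2 ^ lev0.+1)%N ;
  mother_classC : classC A mother ;
  father_classC : forall k, (k < nfather)%N -> classC A (wave lev0 k) ;
  bleft_classC : forall k, (k < bdry)%N -> classC A (bleft k) ;
  bright_classC : forall k, (k < bdry)%N -> classC A (bright k) ;
  mother_supp : forall x, mother x != 0 -> `|x| <= radius ;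
  bleft_supp : forall k x, (k < bdry)%N -> 0 <= x -> bleft k x != 0 ->
    x <= radius ;
  bright_supp : forall k x, (k < bdry)%N -> 0 <= x -> bright k x != 0 ->
    x <= radius ;
  vanishing_moments : forall l k i, (lev0 < l)%N -> (k < nwave l)%N ->
    (i < A)%N -> inner01 (fun x => x ^+ i) (wave l k) = 0 ;
  orthonormal : forall l k l' k', (k < nwave l)%N -> (k' < nwave l')%N ->
    inner01 (wave l k) (wave l' k') = ((l == l') && (k == k'))%:R ;
  complete : forall f, @L2_01 R f ->
    (fun J : nat => sq_dist01 f (fun x => \sum_(l < J) \sum_(k < nwave l)
       inner01 f (wave l k) * wave l k x)) @ \oo --> 0%E ;
  overlap : forall l x, @unit_itv R x ->
    (#|[pred k : 'I_(nwave l) | `[< wsupp l k x >]]|)%:R <= cA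
}.

Section besov.
Context {R : realType} {A : nat} (B : cdv_basis R A).

(* reciprocal, with 1/oo = 0 *)
Definition einv (p : \bar R) : R := if p is r%:E then r^-1 else 0.

Definition lnorm (p : \bar R) (n : nat) (a : 'I_n -> R) : R :=
  if p is r%:E then (\sum_(k < n) `|a k| `^ r) `^ r^-1
  else \big[Num.max/0]_(k < n) `|a k|.

Definition besov_level (alpha : R) (p : \bar R) (f : R -> R) (l : nat) : R :=
  2 `^ (l%:R * (alpha + 2^-1 - einv p)) *
  lnorm p (fun k : 'I_(nwave B l) => inner01 f (wave B l k)).

Definition besov_norm (alpha : R) (p q : \bar R) (f : R -> R) : \bar R :=
  if q is r%:E then
    poweR (\sum_(lev0 B <= l <oo) (besov_level alpha p f l `^ r)%:E)%E r^-1
  else ereal_sup [set (besov_level alpha p f l)%:E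
                 | l in [set l | (lev0 B <= l)%N]].

Definition besov_ball (alpha : R) (p q : \bar R) (rad : R) : set (R -> R) :=
  [set f | @L2_01 R f /\ (besov_norm alpha p q f <= rad%:E)%E].

End besov.

Section protocol.
Context {R : realType} {A : nat} (B : cdv_basis R A).

Definition clip (tau x : R) : R := Num.max (- tau) (Num.min x tau).

(* pairs (l, k) with lev0 <= l <= L (nwave B l = 0 below lev0) *)
Definition coefs (L : nat) := {l : 'I_L.+1 & 'I_(nwave B l)}.

Definition cwave L (c : coefs L) : R -> R := wave B (tag c) (tagged c).

(* An observation is a pair (y, x). *)
Definition local_coef L tau (n : nat) (z : 'I_n -> R * R) (c : coefs L) : R :=
  n%:R^-1 * \sum_(i < n) clip tau (z i).1 * cwave c (z i).2.

Definition transcript L tau (n : nat) (z : 'I_n -> R * R) (w : coefs L -> R) :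
  coefs L -> R := fun c => local_coef tau z c + w c.

Definition mother_sup : R := sup [set `|mother B x| | x in [set: R]].

Definition c_psi : R := 2 * Num.sqrt 2 * Num.sqrt (cA B) * mother_sup.

Definition noise_var (L : nat) (tau : R) (n : nat) (eps delta : R) : R :=
  4 * tau ^+ 2 * 2 ^+ L * c_psi ^+ 2 * ln (2 / delta)
    / (n%:R ^+ 2 * eps ^+ 2).

Section servers.
Context (m : nat) (n : 'I_m -> nat) (eps : 'I_m -> R).

Definition server_v (L : nat) (j : 'I_m) : R :=
  Num.min ((n j)%:R ^+ 2 * eps j ^+ 2) ((n j)%:R * 2 ^+ L).

Definition server_u (L : nat) (j : 'I_m) : R :=
  server_v L j / \sum_(i < m) server_v L i.

Definition estimator L (T : 'I_m -> coefs L -> R) (x : R) : R :=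
  \sum_(c : coefs L) (\sum_(j < m) server_u L j * T j c) * cwave c x.

End servers.

Definition resolution (D : R) : nat :=
  `|Num.max ((lev0 B).+1%:Z) (Num.ceil (ln D / ln 2))|%N.

End protocol.

Section privacy.
Context {R : realType}.

Definition admissible_data (n : nat) (z : 'I_n -> R * R) : Prop :=
  forall i, @unit_itv R (z i).2.

Definition neighbours (n : nat) (z z' : 'I_n -> R * R) : Prop :=
  forall i i', z i <> z' i -> z i' <> z' i' -> i = i'.

Definition product_sigma (I : Type) : set (set (I -> R)) :=
  <<s [set C | exists i (U : set R),
         measurable U /\ C = [set t | U (t i)]] >>.

(* K z E stands for the conditional probability of the event T in E given the
   local data z. *)
Definition diff_private (n : nat) (I : Type) (eps delta : R)
    (K : ('I_n -> R * R) -> set (I -> R) -> \bar R) : Prop :=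
  forall z z', admissible_data z -> admissible_data z' -> neighbours z z' ->
  forall E, @product_sigma I E ->
    (K z E <= (expR eps)%:E * K z' E + delta%:E)%E.

End privacy.

Section model.
Context {R : realType} {A : nat} (B : cdv_basis R A).
Context {d : measure_display} {Omega : measurableType d}
  (P : probability Omega R).

Definition mutually_independent (I : finType) (V : I -> Omega -> R) : Prop :=
  forall (J : {set I}) (U : I -> set R), (forall i, measurable (U i)) ->
    P (\bigcap_(i in [set i | i \in J]) (V i @^-1` U i))
      = (\prod_(i in J) P (V i @^-1` U i))%E.

Definition has_law (V : {RV P >-> R}) (Q : set R -> \bar R) : Prop :=
  forall U : set R, measurable U -> distribution P V U = Q U.

Context (m : nat) (n : 'I_m -> nat) (L : nat).

(* the observation o is number (tagged o) of server (tag o) *)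
Definition obs := {j : 'I_m & 'I_(n j)}.

Definition all_sources (X xi : obs -> {RV P >-> R})
    (W : 'I_m -> coefs B L -> {RV P >-> R}) :
    obs + obs + 'I_m * coefs B L -> Omega -> R := fun i =>
  match i with
  | inl (inl o) => X o
  | inl (inr o) => xi o
  | inr (j, c) => W j c
  end.

Record sampling_model (tau : R) (eps delta : 'I_m -> R)
    (X xi : obs -> {RV P >-> R}) (W : 'I_m -> coefs B L -> {RV P >-> R})
    : Prop := SamplingModel {
  design_range : forall o w, @unit_itv R (X o w) ;
  design_law : forall o, has_law (X o) (uniform_prob (@ltr01 R)) ;
  error_law : forall o, has_law (xi o) (normal_prob 0 1) ;
  (* the second parameter of normal_prob is the standard deviation *)
  noise_law : forall j c, has_law (W j c)
    (normal_prob 0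
       (Num.sqrt (noise_var B L tau (n j) (eps j) (delta j)))) ;
  sources_independent : mutually_independent (all_sources X xi W)
}.

Definition local_data (f : R -> R) (X xi : obs -> {RV P >-> R}) (w : Omega)
    (j : 'I_m) (i : 'I_(n j)) : R * R :=
  let o : obs := Tagged (fun j => 'I_(n j)) i in (f (X o w) + xi o w, X o w).

(* The noise of a server is independent of the data, so this is the
   conditional law of its transcript given its data. *)
Definition transcript_law (tau : R) (k : nat) (Wj : coefs B L -> {RV P >-> R})
    (z : 'I_k -> R * R) (E : set (coefs B L -> R)) : \bar R :=
  P [set w | E (transcript tau z (fun c => Wj c w))].

Definition risk (tau : R) (eps : 'I_m -> R) (X xi : obs -> {RV P >-> R})
    (W : 'I_m -> coefs B L -> {RV P >-> R}) (f : R -> R) : \bar R :=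
  (\int[P]_w sq_dist01
     (estimator n eps (fun j =>
        transcript tau (local_data f X xi w (j := j)) (fun c => W j c w)))
     f)%E.

End model.

(* Main.v *)
Require Import Defs.
From mathcomp Require Import all_boot all_order all_algebra.
From mathcomp Require Import all_classical all_reals all_analysis.
From mathcomp Require Import measurable_realfun simple_functions.
From mathcomp Require Import ring lra.
Set Implicit Arguments.
Unset Strict Implicit.
Unset Printing Implicit Defensive.
Import Order.TTheory GRing.Theory Num.Def Num.Theory.
Import numFieldNormedType.Exports.
Local Open Scope classical_set_scope.
Local Open Scope ring_scope.

(* Parseval splits the risk into the wavelet energy of f above level L and the
   sum of the mean squared errors of the estimated coefficients.  By the power
   mean inequality (p >= 2) the energy at a level l > l0 is at most
   R^2 2^(-2 l alpha), which is summable.  The error of a coefficient consists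
   of the truncation bias, at most E(|xi| - s)_+ with s = tau - C_{alpha,R} and
   hence of order 2^(-L(alpha+1/2)); the sampling variance, at most
   tau^2 sum_j u_j^2 / n_j; and the variance of the privacy noise.  The weights
   u_j make each of the two variances, up to the factors tau^2 and
   log(2/delta'), at most 2^L / sum_j v_j, and the equation defining D gives
   sum_j v_j >= D^(2 alpha+2), where D is comparable to 2^L.  Summing over
   O(2^L) coefficients and using tau^2 = O(L) = O(log N) yields the rate.

   Privacy is the Gaussian mechanism: two neighbouring data sets shift the
   transcript by a vector v, the Cameron-Martin formula expresses the shifted
   law as the density exp(loss) against the unshifted one, and a Chernoff bound
   controls the event that the loss exceeds eps. *)

(** * Integrals against weighted image measures, and independence *)

(** The sources live on an arbitrary probability space and are independent only through a product
    formula for events, so there is no product space to integrate over. The substitute is one change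
    of variables with a weight on the source: weight 1 gives integration against a law, a density
    with the identity map gives integration against [normal_prob], and a weight made of the
    remaining factors gives the factorization of expectations. Second moments, the truncated tail
    and the Chernoff bound are all read off the Gaussian moment generating function; the price is
    the constant 8 exp(1/2) in front of the variance of the privacy noise. The constant of the
    theorem has to be uniform in the servers and in D. As L is at least lev0 + 1, the ratio 2^L / D
    is bounded only if D stays away from 0, which is what [d0 <= D] provides. *)

Section weighted_transfer.
Local Open Scope ereal_scope.
Context d d' (T : measurableType d) (T' : measurableType d') (R : realType).
Variables (mu : {measure set T -> \bar R}) (nu : {measure set T' -> \bar R}).
Variables (h : T -> R) (V : T -> T').
Hypothesis mh : measurable_fun setT h.
Hypothesis h0 : forall x, (0 <= h x)%R.
Hypothesis mV : measurable_fun setT V.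
Hypothesis hnu : forall U, measurable U ->
  \int[mu]_(x in V @^-1` U) (h x)%:E = nu U.

Import HBNNSimple.

Let mhE : measurable_fun setT (fun x => (h x)%:E).
Proof. exact/measurable_EFinP. Qed.

Let weighted_indic U : measurable U ->
  \int[mu]_x ((h x)%:E * (\1_U (V x))%:E) = \int[nu]_y (\1_U y)%:E.
Proof.
move=> mU; rewrite integral_indic// setIT -hnu//.
rewrite [RHS]integral_mkcond; apply: eq_integral => x _.
rewrite patchE indicE; have [/set_mem Ux|/negP Ux] := boolP (V x \in U).
  by rewrite mem_set// mule1.
by rewrite memNset ?mule0// => /mem_set.
Qed.

Let weighted_nnsfun (f : {nnsfun T' >-> R}) :
  \int[mu]_x ((h x)%:E * (f (V x))%:E) = \int[nu]_y (f y)%:E.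
Proof.
have mi (r : R) : measurable_fun setT (fun y : T' => (\1_(f @^-1` [set r]) y : R)).
  exact: measurable_indic.
under [RHS]eq_integral do rewrite fimfunE -fsumEFin//.
rewrite [RHS]ge0_integral_fsum//; last 2 first.
  - by move=> r; exact/measurable_EFinP/measurableT_comp.
  - by move=> n x _; rewrite EFinM nnfun_muleindic_ge0.
under [LHS]eq_integral.
  move=> x xD; rewrite fimfunE -fsumEFin// ge0_mule_fsumr; last first.
    by move=> r; rewrite EFinM nnfun_muleindic_ge0.
  over.
rewrite [LHS]ge0_integral_fsum//; last 2 first.
  - move=> r; apply: emeasurable_funM => //.
    apply/measurable_EFinP; apply: measurable_funM => //.
    exact: (measurableT_comp (mi r)).
  - move=> n x _; apply: mule_ge0; first by rewrite lee_fin.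
    by rewrite EFinM (nnfun_muleindic_ge0 f).
apply: eq_fsbigr => r /[!inE] -[y _ fy].
have r0 : (0 <= r)%R by rewrite -fy.
under eq_integral do rewrite EFinM muleCA.
rewrite ge0_integralZl//; last 2 first.
  - apply: emeasurable_funM => //; apply/measurable_EFinP.
    exact: (measurableT_comp (mi r)).
  - by move=> x _; rewrite mule_ge0// lee_fin.
rewrite weighted_indic//.
under [RHS]eq_integral do rewrite EFinM.
by rewrite ge0_integralZl//; exact/measurable_EFinP.
Qed.

(** For indicators this is [hnu]. Linearity extends it to simple functions, and monotone convergence
    along [nnsfun_approx], on both sides at once, to every nonnegative [g]. *)
Lemma ge0_integral_weighted (g : T' -> \bar R) : measurable_fun setT g ->
  (forall y, 0 <= g y) ->
  \int[mu]_x ((h x)%:E * g (V x)) = \int[nu]_y g y.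
Proof.
move=> mg g0; pose f_ := nnsfun_approx measurableT mg.
transitivity (lim (\int[mu]_x ((h x)%:E * (f_ n (V x))%:E) @[n --> \oo])).
  rewrite -monotone_convergence//=.
  - apply: eq_integral => x _; apply/esym/cvg_lim => //=.
    apply: cvgeZl => //.
    by have := @cvg_nnsfun_approx _ _ _ _ measurableT g mg (fun x _ => g0 x) (V x) I.
  - move=> n; apply: emeasurable_funM => //; apply/measurable_EFinP.
    exact: measurableT_comp.
  - by move=> n ? _; rewrite mule_ge0// lee_fin.
  - move=> x _ a b ab; apply: lee_pmul => //; rewrite lee_fin//.
    by exact/lefP/nd_nnsfun_approx.
under eq_fun do rewrite weighted_nnsfun.
rewrite -monotone_convergence//=.
- apply: eq_integral => y _; apply/cvg_lim => //=.
  exact: cvg_nnsfun_approx.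
- by move=> n; exact/measurable_EFinP.
- by move=> n ? _; rewrite lee_fin.
- by move=> x _ a b ab; rewrite lee_fin; exact/lefP/nd_nnsfun_approx.
Qed.

Lemma integrable_weighted (g : T' -> R) : measurable_fun setT g ->
  nu.-integrable setT (EFin \o g) ->
  mu.-integrable setT (EFin \o (fun x => h x * g (V x))%R).
Proof.
move=> mg /integrableP[_ ig]; apply/integrableP; split.
  apply/measurable_EFinP; apply: measurable_funM => //.
  exact: measurableT_comp.
under eq_integral do rewrite /= normrM (ger0_norm (h0 _)) EFinM.
rewrite (ge0_integral_weighted (g := fun y => `|g y|%:E))//.
by apply/measurable_EFinP; exact: measurableT_comp.
Qed.

Lemma Rintegral_weighted (g : T' -> R) : measurable_fun setT g ->
  nu.-integrable setT (EFin \o g) ->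
  (\int[mu]_x (h x * g (V x)) = \int[nu]_y g y)%R.
Proof.
move=> mg ig.
have mgp := measurable_funrpos mg; have mgn := measurable_funrneg mg.
have ip := integrable_funrpos measurableT ig.
have im := integrable_funrneg measurableT ig.
have wp : \int[mu]_x ((h x)%:E * (g^\+%R (V x))%:E) = \int[nu]_y (g^\+%R y)%:E.
  apply: (ge0_integral_weighted (g := fun y => (g^\+%R y)%:E)).
    exact/measurable_EFinP.
  by move=> y; rewrite lee_fin.
have wm : \int[mu]_x ((h x)%:E * (g^\-%R (V x))%:E) = \int[nu]_y (g^\-%R y)%:E.
  apply: (ge0_integral_weighted (g := fun y => (g^\-%R y)%:E)).
    exact/measurable_EFinP.
  by move=> y; rewrite lee_fin.
transitivity (\int[nu]_y (g^\+%R y - g^\-%R y))%R; last first.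
  by apply: eq_Rintegral => y _; rewrite -[in RHS](funrposBneg g).
rewrite (@RintegralB _ _ _ nu)//.
transitivity (\int[mu]_x (h x * g^\+%R (V x) - h x * g^\-%R (V x)))%R.
  apply: eq_Rintegral => x _; rewrite -mulrBr; congr (_ * _)%R.
  by rewrite -[in LHS](funrposBneg g).
rewrite RintegralB//.
- by congr (_ - _)%R; rewrite /Rintegral; congr fine.
- exact: integrable_weighted.
- exact: integrable_weighted.
Qed.

End weighted_transfer.

Lemma measurable_preimage d d' (T : measurableType d) (T' : measurableType d')
    (V : T -> T') (U : set T') :
  measurable_fun setT V -> measurable U -> measurable (V @^-1` U).
Proof. by move=> mV mU; rewrite -[X in measurable X]setTI; exact: mV. Qed.

Section independence_pair.
Context d d1 d2 (T : measurableType d) (T1 : measurableType d1)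
  (T2 : measurableType d2) (R : realType) (P : probability T R).

Definition indep_vars (U : T -> T1) (V : T -> T2) : Prop :=
  forall A B, measurable A -> measurable B ->
    P (U @^-1` A `&` V @^-1` B) = (P (U @^-1` A) * P (V @^-1` B))%E.

Lemma ge0_indep_varsM (U : T -> T1) (V : T -> T2) (h : T1 -> R) (g : T2 -> R) :
  measurable_fun setT U -> measurable_fun setT V -> indep_vars U V ->
  measurable_fun setT h -> measurable_fun setT g ->
  (forall x, 0 <= h x) -> (forall x, 0 <= g x) ->
  (\int[P]_x (h (U x))%:E < +oo)%E -> (\int[P]_x (g (V x))%:E < +oo)%E ->
  (\int[P]_x (h (U x) * g (V x))%:E =
   \int[P]_x (h (U x))%:E * \int[P]_x (g (V x))%:E)%E.
Proof.
move=> mU mV iUV mh mg h0 g0 hoo goo.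
have mhU : measurable_fun setT (h \o U) by exact: measurableT_comp.
have mgV : measurable_fun setT (g \o V) by exact: measurableT_comp.
pose Uf := mfun_Sub (mem_set mU : U \in mfun); pose Vf := mfun_Sub (mem_set mV : V \in mfun).
have fing : (\int[P]_x (g (V x))%:E \is a fin_num)%E.
  by rewrite ge0_fin_numE// integral_ge0// => x _; rewrite lee_fin.
have ff A : measurable A -> (P A \is a fin_num)%E by move=> mA; exact: fin_num_measure.
(* If [h] is an indicator, this is a change of variables to the law of [V]
   weighted by [P (U @^-1` A)]; a second change of variables, now to the law of
   [U] and with the weight [g \o V], gives the general case. *)
have step1 A : measurable A ->
    (\int[P]_(x in U @^-1` A) (g (V x))%:E =
     \int[P]_x (g (V x))%:E * P (U @^-1` A))%E.
  move=> mA.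
  have mUA : measurable (U @^-1` A) by exact: measurable_preimage.
  have p0 : 0 <= fine (P (U @^-1` A)) by exact/fine_ge0/measure_ge0.
  pose nu : {measure set _ -> \bar R} := mscale (NngNum p0) (distribution P Vf).
  have mi : measurable_fun setT (\1_(U @^-1` A) : T -> R) by exact: measurable_indic.
  have E1 := @ge0_integral_weighted _ _ T T2 R P nu (\1_(U @^-1` A)) V
    mi _ mV _ (EFin \o g).
  transitivity (\int[P]_x ((\1_(U @^-1` A) x)%:E * (g (V x))%:E))%E.
    rewrite [LHS]integral_mkcond; apply: eq_integral => x _.
    rewrite patchE indicE; case: ifPn => _; first by rewrite mul1e.
    by rewrite mul0e.
  rewrite E1//; last 2 first.
  - move=> B mB; rewrite integral_indic//=; last first.
      exact: measurable_preimage.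
    by rewrite /nu /mscale/= fineK ?ff// iUV.
  - exact/measurable_EFinP.
  rewrite /nu ge0_integral_mscale//=; last 2 first.
    exact/measurable_EFinP.
    by move=> y _; rewrite /= lee_fin.
  rewrite (ge0_integral_distribution Vf)//=; last exact/measurable_EFinP.
  by rewrite fineK ?ff// muleC.
have q0 : 0 <= fine (\int[P]_x (g (V x))%:E)%E.
  by apply/fine_ge0/integral_ge0 => x _; rewrite lee_fin.
pose nu : {measure set _ -> \bar R} := mscale (NngNum q0) (distribution P Uf).
have E2 := @ge0_integral_weighted _ _ T T1 R P nu (g \o V) U
    mgV _ mU _ (EFin \o h).
transitivity (\int[P]_x ((g (V x))%:E * (h (U x))%:E))%E.
  by apply: eq_integral => x _; rewrite -EFinM mulrC.
rewrite E2//; last 3 first.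
- by move=> x; exact: g0.
- by move=> A mA; rewrite /= step1// /nu/= /mscale/= fineK.
- exact/measurable_EFinP.
rewrite /nu ge0_integral_mscale//=; last 2 first.
  exact/measurable_EFinP.
  by move=> y _; rewrite /= lee_fin.
rewrite (ge0_integral_distribution Uf)//=; last exact/measurable_EFinP.
by rewrite fineK// muleC.
Qed.

(** The nonnegative case applies to the four products of positive and negative parts, and
    bilinearity recombines them. Finiteness of the separate means makes each product integrable. *)
Lemma indep_varsM (U : T -> T1) (V : T -> T2) (h : T1 -> R) (g : T2 -> R) :
  measurable_fun setT U -> measurable_fun setT V -> indep_vars U V ->
  measurable_fun setT h -> measurable_fun setT g ->
  P.-integrable setT (EFin \o (h \o U)) -> P.-integrable setT (EFin \o (g \o V)) ->
  P.-integrable setT (EFin \o (fun x => h (U x) * g (V x))) /\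
  \int[P]_x (h (U x) * g (V x)) = \int[P]_x h (U x) * \int[P]_x g (V x).
Proof.
move=> mU mV iUV mh mg ih ig.
have mhU : measurable_fun setT (h \o U) by exact: measurableT_comp.
have mgV : measurable_fun setT (g \o V) by exact: measurableT_comp.
have /integrableP[_ hoo] := ih; have /integrableP[_ goo] := ig.
have posM (h' : T1 -> R) (g' : T2 -> R) :
    measurable_fun setT h' -> measurable_fun setT g' ->
    (forall x, 0 <= h' x) -> (forall x, 0 <= g' x) ->
    P.-integrable setT (EFin \o (h' \o U)) -> P.-integrable setT (EFin \o (g' \o V)) ->
    P.-integrable setT (EFin \o (fun x => h' (U x) * g' (V x))) /\
    \int[P]_x (h' (U x) * g' (V x)) = \int[P]_x h' (U x) * \int[P]_x g' (V x).
  move=> mh' mg' h0 g0 ih' ig'.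
  have fh : (\int[P]_x (h' (U x))%:E \is a fin_num)%E := integrable_fin_num measurableT ih'.
  have fg : (\int[P]_x (g' (V x))%:E \is a fin_num)%E := integrable_fin_num measurableT ig'.
  have Ih : (0 <= \int[P]_x (h' (U x))%:E)%E by apply: integral_ge0 => x _; rewrite lee_fin.
  have Ig : (0 <= \int[P]_x (g' (V x))%:E)%E by apply: integral_ge0 => x _; rewrite lee_fin.
  have hoo' : (\int[P]_x (h' (U x))%:E < +oo)%E by rewrite -ge0_fin_numE.
  have goo' : (\int[P]_x (g' (V x))%:E < +oo)%E by rewrite -ge0_fin_numE.
  have E := ge0_indep_varsM mU mV iUV mh' mg' h0 g0 hoo' goo'.
  split; last by rewrite /Rintegral E fineM.
  apply/integrableP; split.
    apply/measurable_EFinP; apply: measurable_funM; exact: measurableT_comp.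
  under eq_integral do rewrite /= ger0_norm ?mulr_ge0//.
  by rewrite E lte_mul_pinfty.
have ihp : P.-integrable setT (EFin \o (h^\+ \o U)) := integrable_funrpos measurableT ih.
have ihn : P.-integrable setT (EFin \o (h^\- \o U)) := integrable_funrneg measurableT ih.
have igp : P.-integrable setT (EFin \o (g^\+ \o V)) := integrable_funrpos measurableT ig.
have ign : P.-integrable setT (EFin \o (g^\- \o V)) := integrable_funrneg measurableT ig.
have mhp := measurable_funrpos mh; have mhn := measurable_funrneg mh.
have mgp := measurable_funrpos mg; have mgn := measurable_funrneg mg.
have [i1 e1] := posM _ _ mhp mgp (funrpos_ge0 h) (funrpos_ge0 g) ihp igp.
have [i2 e2] := posM _ _ mhp mgn (funrpos_ge0 h) (funrneg_ge0 g) ihp ign.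
have [i3 e3] := posM _ _ mhn mgp (funrneg_ge0 h) (funrpos_ge0 g) ihn igp.
have [i4 e4] := posM _ _ mhn mgn (funrneg_ge0 h) (funrneg_ge0 g) ihn ign.
have i12 := integrableB measurableT i1 i2.
have i34 := integrableB measurableT i3 i4.
have hE x : h x = h^\+ x - h^\- x by rewrite -[in LHS](funrposBneg h).
have gE x : g x = g^\+ x - g^\- x by rewrite -[in LHS](funrposBneg g).
have -> : (fun x => h (U x) * g (V x)) =
    (fun x => (h^\+ (U x) * g^\+ (V x) - h^\+ (U x) * g^\- (V x)) -
              (h^\- (U x) * g^\+ (V x) - h^\- (U x) * g^\- (V x))).
  by apply/funext => x; rewrite hE gE; ring.
split.
  have := integrableB measurableT i12 i34.
  by apply: eq_integrable.
rewrite RintegralB// RintegralB// RintegralB// e1 e2 e3 e4.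
have -> : \int[P]_x h (U x) = \int[P]_x h^\+ (U x) - \int[P]_x h^\- (U x).
  rewrite -RintegralB//; apply: eq_Rintegral => x _; exact: hE.
have -> : \int[P]_x g (V x) = \int[P]_x g^\+ (V x) - \int[P]_x g^\- (V x).
  rewrite -RintegralB//; apply: eq_Rintegral => x _; exact: gE.
ring.
Qed.

End independence_pair.

Section independence_generated.
Context d d1 (T : measurableType d) (T1 : measurableType d1) (R : realType)
  (P : probability T R).

(** For a fixed event [S] the sets that obey the product rule form a Dynkin system. Freezing [S]
    allows the two sides of an independence statement to be extended one after the other. *)
Lemma indep_event_generated (G : set (set T1)) (U : T -> T1) (S : set T) :
  @measurable _ T1 = <<s G >> -> setI_closed G ->
  measurable_fun setT U -> measurable S ->
  (forall A, G A -> P (U @^-1` A `&` S) = (P (U @^-1` A) * P S)%E) ->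
  forall A, measurable A -> P (U @^-1` A `&` S) = (P (U @^-1` A) * P S)%E.
Proof.
move=> GE GI mU mS GP A mA.
have mUA E : measurable E -> measurable (U @^-1` E).
  exact: measurable_preimage.
have ff E : measurable E -> (P E \is a fin_num)%E by move=> mE; exact: fin_num_measure.
apply: (@dynkin_induction _ T1 G (fun A => P (U @^-1` A `&` S) =
   (P (U @^-1` A) * P S)%E)) => //; last by rewrite -GE.
- by rewrite preimage_setT setTI probability_setT mul1e.
- move=> E mE IH.
  have -> : U @^-1` (~` E) = ~` (U @^-1` E) by [].
  have -> : P (~` (U @^-1` E) `&` S) = (P S - P (U @^-1` E `&` S))%E.
    rewrite setIC -setDE measureD//; [by rewrite setIC|exact: mUA|].
    by rewrite (le_lt_trans (probability_le1 _ _))// ltry.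
  rewrite IH probability_setC; last exact: mUA.
  rewrite -[P S]fineK ?ff// -[P (U @^-1` E)]fineK; last by apply: ff; exact: mUA.
  by rewrite -!EFinM -!EFinB; congr EFin; ring.
- move=> F mF tF IH; rewrite preimage_bigcup setI_bigcupl.
  rewrite measure_semi_bigcup//; last 3 first.
  + by move=> i; apply: measurableI => //; exact: mUA.
  + by move=> i j _ _ [x [[Fi _] [Fj _]]]; apply: tF => //; exists (U x).
  + apply: bigcup_measurable => i _; apply: measurableI => //; exact: mUA.
  rewrite measure_semi_bigcup//; last 3 first.
  + by move=> i; exact: mUA.
  + by move=> i j _ _ [x [Fi Fj]]; apply: tF => //; exists (U x).
  + by apply: bigcup_measurable => i _; exact: mUA.
  rewrite [RHS]muleC -[P S]fineK ?ff// -nneseriesZl//.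
  by apply: eq_eseriesr => i _; rewrite fineK ?ff// muleC; exact: IH.
Qed.

End independence_generated.

Lemma measurable_fun_prodr d (T : measurableType d) (R : realType) (I : Type)
    (r : seq I) (p : pred I) (h : I -> T -> R) (D : set T) :
  (forall i, p i -> measurable_fun D (h i)) ->
  measurable_fun D (fun x => \prod_(i <- r | p i) h i x).
Proof.
move=> mh; elim: r => [|a r IH].
  by under eq_fun do rewrite big_nil; exact: measurable_cst.
have [pa|pa] := boolP (p a).
  under eq_fun do rewrite big_cons pa.
  by apply: measurable_funM => //; exact: mh.
by under eq_fun do rewrite big_cons (negbTE pa).
Qed.

Section independence_family.
Context d (T : measurableType d) (R : realType) (P : probability T R).

Lemma mutually_independent_sub (I I' : finType) (f : I' -> I)
    (V : I -> T -> R) : injective f ->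
  mutually_independent P V -> mutually_independent P (V \o f).
Proof.
move=> fI iV J U mU.
pose U' i := if [pick i' | f i' == i] is Some i' then U i' else setT.
have U'f i : U' (f i) = U i.
  rewrite /U'; case: pickP => [j /eqP/fI ->//|/(_ i)]; by rewrite eqxx.
have mU' i : measurable (U' i) by rewrite /U'; case: pickP.
have := iV (f @: J)%SET U' mU'.
rewrite big_imset/=; last by move=> ? ? _ _; exact: fI.
under eq_bigr do rewrite U'f.
move=> <-; congr (P _).
apply/seteqP; split => x /= H i /=.
  by move=> /imsetP[j jJ ->]; rewrite /preimage /= U'f; exact: H.
by move=> iJ; have := H (f i); rewrite /preimage /= U'f; apply; exact: imset_f.
Qed.

Lemma mutually_independent_prob (I : finType) (V : I -> T -> R)
    (U : I -> set R) : mutually_independent P V ->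
  (forall i, measurable (U i)) ->
  P [set x | forall i, U i (V i x)] = (\prod_i P (V i @^-1` U i))%E.
Proof.
move=> iV mU; have := iV [set: I]%SET U mU.
rewrite (eq_bigl xpredT); last by move=> i; rewrite inE.
move=> <-; congr (P _); apply/seteqP; split => x H i /=; last first.
  by apply: (H i); rewrite /= inE.
by move=> _; exact: H.
Qed.

(** The functions are inserted one at a time: indices in the list [s] carry [g i], all others the
    indicator of [U i]. Keeping [U] universally quantified closes the induction, because varying the
    set at the new index [a] identifies the weighted law of [V a]. *)
Lemma ge0_integral_prod_indep (I : finType) (V : I -> {mfun T >-> R})
    (g : I -> R -> R) (e : I -> R) :
  mutually_independent P (fun i => V i) ->
  (forall i, measurable_fun setT (g i)) -> (forall i x, 0 <= g i x) ->
  (forall i, \int[P]_x (g i (V i x))%:E = (e i)%:E)%E ->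
  (\int[P]_x (\prod_i g i (V i x))%:E = (\prod_i e i)%:E)%E.
Proof.
move=> iV mg g0 ge.
have mV i : measurable_fun setT (V i) by [].
pose G (U : I -> set R) (s : seq I) i := if i \in s then g i else \1_(U i).
pose e' (U : I -> set R) (s : seq I) i :=
  if i \in s then e i else fine (P (V i @^-1` U i)).
have e0 i : 0 <= e i.
  by rewrite -lee_fin -ge; apply: integral_ge0 => x _; rewrite lee_fin.
have e'0 U s i : 0 <= e' U s i.
  by rewrite /e'; case: ifP => // _; exact/fine_ge0/measure_ge0.
have G0 U s i x : 0 <= G U s i x by rewrite /G; case: ifP.
have mG U s i : (forall i, measurable (U i)) -> measurable_fun setT (G U s i).
  by move=> mU; rewrite /G; case: ifP => // _; exact: measurable_indic.
suff main s : forall U : I -> set R, (forall i, measurable (U i)) ->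
    (\int[P]_x (\prod_i G U s i (V i x))%:E = (\prod_i e' U s i)%:E)%E.
  have := main (enum I) (fun=> setT) (fun=> measurableT).
  rewrite /G /e'.
  under eq_integral do under eq_bigr do rewrite mem_enum inE.
  by move=> ->; congr EFin; apply: eq_bigr => i _; rewrite mem_enum inE.
elim: s => [U mU|a s IH U mU].
  have mUU : measurable [set x | forall i, U i (V i x)].
    rewrite (_ : [set x | _] = \bigcap_(i in [set: I]) (V i @^-1` U i)).
      by apply: fin_bigcap_measurable => // i _; exact: measurable_preimage.
    by apply/seteqP; split => x /= h i; [move=> _|]; exact: h.
  transitivity (\int[P]_x (\1_[set x | forall i, U i (V i x)] x)%:E)%E.
    have GE i : G U [::] i = \1_(U i) by [].
    apply: eq_integral => x _; congr EFin; rewrite [RHS]indicE.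
    have [/set_mem H|/negP H] := boolP (x \in _).
      by apply: big1 => i _; rewrite GE indicE mem_set//; exact: H.
    apply/eqP/prodf_eq0; apply: contrapT => H'; apply: H; apply/mem_set => i.
    apply: contrapT => nU; apply: H'; exists i => //.
    by rewrite GE indicE memNset.
  rewrite integral_indic// setIT.
  transitivity (P [set x | forall i, U i (V i x)]); first by [].
  rewrite (mutually_independent_prob iV mU).
  rewrite (big_morph EFin EFinM (erefl _)); apply: eq_bigr => i _.
  rewrite /e' /= fineK//; apply: fin_num_measure.
  exact: measurable_preimage.
have [as'|as'] := boolP (a \in s).
  have E i : (i \in a :: s) = (i \in s).
    by rewrite inE; case: eqVneq => [->|]; rewrite ?as'.
  rewrite /G /e'; under eq_integral do under eq_bigr do rewrite E.
  by rewrite (IH U mU); congr EFin; apply: eq_bigr => i _; rewrite /e' E.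
(* The product of all other factors acts as a weight; under it the image measure of [V a] is the
   multiple [nu] of its law. *)
pose H x := \prod_(i | i != a) G U s i (V i x).
have H0 x : 0 <= H x by apply: prodr_ge0 => i _; exact: G0.
have mH : measurable_fun setT H.
  apply: measurable_fun_prodr => i _.
  by apply: measurableT_comp => //; exact: mG.
have c0 : 0 <= \prod_(i | i != a) e' U s i by apply: prodr_ge0 => i _; exact: e'0.
pose nu : {measure set _ -> \bar R} := mscale (NngNum c0) (distribution P (V a)).
have ia i : i != a -> (i \in a :: s) = (i \in s).
  by rewrite inE => /negbTE ->.
transitivity (\int[P]_x ((H x)%:E * (g a (V a x))%:E))%E.
  apply: eq_integral => x _; rewrite -EFinM; congr EFin.
  rewrite (bigD1 a)//= mulrC; congr (_ * _).
    by apply: eq_bigr => i ia'; rewrite /G ia.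
  by rewrite /G inE eqxx.
have E := @ge0_integral_weighted _ _ T _ R P nu H (V a)
    mH H0 (mV a) _ (EFin \o g a).
rewrite E; last 3 first.
- move=> A mA.
  (* The induction hypothesis with [A] in place of [U a] is exactly the identity that characterizes
     [nu]. *)
  pose UA i := if i == a then A else U i.
  have mUA i : measurable (UA i) by rewrite /UA; case: ifP.
  have := IH UA mUA; rewrite (bigD1 a)//=.
  have -> : e' UA s a = fine (P (V a @^-1` A)) by rewrite /e' (negbTE as') /UA eqxx.
  have -> : \prod_(i | i != a) e' UA s i = \prod_(i | i != a) e' U s i.
    by apply: eq_bigr => i ia'; rewrite /e' /UA (negbTE ia').
  rewrite mulrC /nu /= /mscale /= EFinM fineK; last first.
    by apply: fin_num_measure; exact: measurable_preimage.
  move=> <-; rewrite [LHS]integral_mkcond; apply: eq_integral => x _.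
  rewrite patchE (bigD1 a)//=.
  have -> : G UA s a = \1_A by rewrite /G (negbTE as') /UA eqxx.
  have -> : \prod_(i | i != a) G UA s i (V i x) = H x.
    by apply: eq_bigr => i ia'; rewrite /G /UA (negbTE ia').
  rewrite indicE; have [/set_mem Ux|/negP Ux] := boolP (x \in _).
    by rewrite mem_set// mul1r.
  by rewrite memNset ?mul0r// => /mem_set.
- exact/measurable_EFinP.
- by move=> y; rewrite /= lee_fin.
rewrite /nu ge0_integral_mscale//=; last 2 first.
  exact/measurable_EFinP.
  by move=> y _; rewrite /= lee_fin.
rewrite (ge0_integral_distribution (V a))/=; last 2 first.
- exact/measurable_EFinP.
- by move=> y; rewrite /= lee_fin.
rewrite ge -EFinM; congr EFin; rewrite [RHS](bigD1 a)//= mulrC; congr (_ * _).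
  by rewrite /e' inE eqxx.
by apply: eq_bigr => i ia'; rewrite /e' ia.
Qed.

End independence_family.

(** * Normal random variables *)

Section laws.
Context d (T : measurableType d) (R : realType) (P : probability T R).

Lemma law_preimage (V : {RV P >-> R}) (nu : {measure set (measurableTypeR R) -> \bar R})
    (U : set R) : has_law V nu -> measurable U ->
  (\int[P]_(x in V @^-1` U) (cst 1 x)%:E = nu U)%E.
Proof.
move=> lV mU; transitivity (\int[P]_(x in V @^-1` U) cst 1%E x)%E; first by [].
by rewrite integral_cst ?mul1e -?lV//; exact: measurable_preimage.
Qed.

Lemma ge0_integral_law (V : {RV P >-> R}) (nu : {measure set (measurableTypeR R) -> \bar R})
    (g : R -> R) :
  has_law V nu -> measurable_fun setT g -> (forall x, 0 <= g x) ->
  (\int[P]_w (g (V w))%:E = \int[nu]_x (g x)%:E)%E.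
Proof.
move=> lV mg g0.
have mgE : measurable_fun setT (EFin \o g) by exact/measurable_EFinP.
have mV : measurable_fun setT V by [].
rewrite -(@ge0_integral_weighted _ _ _ _ R P nu (cst 1) V (measurable_cst _) (fun=> ler01) mV
  (fun U => law_preimage lV) (EFin \o g) mgE (fun x => g0 x)).
by apply: eq_integral => x _; rewrite mul1e.
Qed.

Lemma integrable_law (V : {RV P >-> R}) (nu : {measure set (measurableTypeR R) -> \bar R})
    (g : R -> R) :
  has_law V nu -> measurable_fun setT g ->
  nu.-integrable setT (EFin \o g) -> P.-integrable setT (EFin \o (g \o V)).
Proof.
move=> lV mg ig.
have mV : measurable_fun setT V by [].
have := @integrable_weighted _ _ _ _ R P nu (cst 1) V (measurable_cst _) (fun=> ler01) mV
  (fun U => law_preimage lV) g mg ig.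
by apply: eq_integrable => // x _; rewrite /= mul1r.
Qed.

Lemma Rintegral_law (V : {RV P >-> R}) (nu : {measure set (measurableTypeR R) -> \bar R})
    (g : R -> R) :
  has_law V nu -> measurable_fun setT g ->
  nu.-integrable setT (EFin \o g) -> \int[P]_w g (V w) = \int[nu]_x g x.
Proof.
move=> lV mg ig.
have mV : measurable_fun setT V by [].
rewrite -(@Rintegral_weighted _ _ _ _ R P nu (cst 1) V (measurable_cst _) (fun=> ler01) mV
  (fun U => law_preimage lV) g mg ig).
by apply: eq_Rintegral => x _; rewrite mul1r.
Qed.

End laws.

Lemma eq_opp_eq0 (R : numDomainType) (x : R) : x = - x -> x = 0.
Proof.
by move=> /eqP; rewrite -subr_eq0 opprK -mulr2n mulrn_eq0 => /eqP.
Qed.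

Section normal.
Context (R : realType).
Local Notation lebesgue := (@lebesgue_measure R).

Lemma ge0_integral_normal (m s : R) (g : R -> R) :
  measurable_fun setT g -> (forall x, 0 <= g x) ->
  (\int[normal_prob m s]_x (g x)%:E =
   \int[lebesgue]_x (g x * normal_pdf m s x)%:E)%E.
Proof.
move=> mg g0.
rewrite -(@ge0_integral_weighted _ _ _ _ R lebesgue (normal_prob m s)
  (normal_pdf m s) id _ _ _ _ (EFin \o g))//.
- by apply: eq_integral => x _; rewrite -EFinM mulrC.
- exact: measurable_normal_pdf.
- exact: normal_pdf_ge0.
- exact/measurable_EFinP.
Qed.

(* Completing the square turns the exponential tilt into a shift of the mean. *)
Lemma expR_normal_pdf (s a x : R) : s != 0 ->
  expR (a * x) * normal_pdf 0 s x =
  expR (a ^+ 2 * s ^+ 2 / 2) * normal_pdf (a * s ^+ 2) s x.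
Proof.
move=> s0; rewrite !normal_pdfE// /normal_fun.
rewrite mulrCA [RHS]mulrCA -!expRD; congr (_ * expR _).
rewrite -!(mulr_natr (s ^+ 2)) subr0.
by field; rewrite s0.
Qed.

Lemma normal_pdf_shift (m s v x : R) : s != 0 ->
  normal_pdf m s (x - v) = normal_pdf (m + v) s x.
Proof.
move=> s0; rewrite !normal_pdfE// /normal_fun.
by rewrite -addrA -opprD (addrC v).
Qed.

(** Serves two symmetries: the translation behind [normal_prob_shift] and the reflection that makes
    the normal mean vanish. *)
Lemma integral_lebesgue_preserving (phi : R -> R) (U : set R) (g : R -> R) :
  measurable_fun setT phi ->
  (forall A, measurable A -> lebesgue (phi @^-1` A) = lebesgue A) ->
  measurable U -> measurable_fun setT g -> (forall x, 0 <= g x) ->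
  (\int[lebesgue]_(x in phi @^-1` U) (g (phi x))%:E =
   \int[lebesgue]_(x in U) (g x)%:E)%E.
Proof.
move=> mphi lphi mU mg g0.
have lU A : measurable A ->
    (\int[lebesgue]_(x in phi @^-1` A) (cst 1 x)%:E = lebesgue A)%E.
  move=> mA; transitivity (\int[lebesgue]_(x in phi @^-1` A) cst 1%E x)%E; first by [].
  have mp := measurable_preimage mphi mA.
  by rewrite integral_cst// mul1e; exact: lphi.
have mU1 : measurable_fun setT (\1_U : R -> R) by exact: measurable_indic.
have := @ge0_integral_weighted _ _ _ _ R lebesgue lebesgue (cst 1) phi
  (measurable_cst _) (fun=> ler01) mphi lU (fun x => (\1_U x * g x)%:E).
have E A (f : R -> R) : (\int[lebesgue]_(x in A) (f x)%:E =
    \int[lebesgue]_x (\1_A x * f x)%:E)%E.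
  rewrite integral_mkcond; apply: eq_integral => x _; rewrite patchE indicE.
  by case: ifPn; rewrite ?mul1r ?mul0r.
rewrite [X in _ -> X = _]E [X in _ -> _ = X]E => <-.
- by apply: eq_integral => x _; rewrite mul1e.
- by apply/measurable_EFinP; exact: measurable_funM.
- by move=> x; rewrite lee_fin mulr_ge0.
Qed.

Lemma lebesgue_measure_shift (v : R) (A : set R) : measurable A ->
  lebesgue ((fun x => x + v) @^-1` A) = lebesgue A.
Proof.
move=> mA.
have mv : measurable_fun setT ((fun x : R => x + v) : R -> measurableTypeR R).
  exact: measurable_funD.
change (pushforward lebesgue ((fun x : R => x + v) : _ -> measurableTypeR R) A = lebesgue A).
apply/esym/lebesgue_measure_unique => //= _ [[a b]] _ <-.
rewrite /pushforward /=.
rewrite (_ : _ @^-1` _ = `]a - v, b - v]%classic).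
  rewrite !lebesgue_measure_itv/= !lte_fin ltrD2r; case: ifP => // _.
  by rewrite -!EFinB; congr EFin; ring.
by apply/seteqP; split => x /=; rewrite !in_itv/= ltrBlDr lerBrDr.
Qed.

Lemma normal_prob_shift (s v : R) (U : set R) : s != 0 -> measurable U ->
  normal_prob 0 s ((fun x => x + v) @^-1` U) = normal_prob v s U.
Proof.
move=> s0 mU; rewrite /normal_prob.
have mv : measurable_fun setT (fun x : R => x + v) by exact: measurable_funD.
rewrite -(integral_lebesgue_preserving mv (fun A => @lebesgue_measure_shift v A)
  mU (@measurable_normal_pdf _ v s) (@normal_pdf_ge0 _ v s)).
apply: eq_integral => x _; congr EFin.
by have := normal_pdf_shift 0 v (x + v) s0; rewrite addrK add0r.
Qed.

Lemma measurable_expRM (a : R) : measurable_fun setT (fun x : R => expR (a * x)).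
Proof. by apply: measurableT_comp => //; exact: measurable_funM. Qed.

Lemma normal_mgf (s a : R) : s != 0 ->
  (\int[normal_prob 0 s]_x (expR (a * x))%:E =
   (expR (a ^+ 2 * s ^+ 2 / 2))%:E)%E.
Proof.
move=> s0; have me := measurable_expRM a.
rewrite ge0_integral_normal//.
under eq_integral do rewrite expR_normal_pdf// EFinM.
rewrite ge0_integralZl//.
- by rewrite integral_normal_pdf mule1.
- by apply/measurable_EFinP; exact: measurable_normal_pdf.
- by move=> x _; rewrite lee_fin normal_pdf_ge0.
Qed.

(** The Esscher transform: the normalised weight exp(a x) moves the mean from 0 to a s^2 and keeps
    the variance. *)
Lemma normal_tilt (s a : R) (U : set R) : s != 0 -> measurable U ->
  (\int[normal_prob 0 s]_x (\1_U x * expR (a * x - a ^+ 2 * s ^+ 2 / 2))%:E =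
   normal_prob (a * s ^+ 2)%R s U)%E.
Proof.
move=> s0 mU.
have me : measurable_fun setT (fun x : R => expR (a * x - a ^+ 2 * s ^+ 2 / 2)).
  apply: measurableT_comp => //; apply: measurable_funB => //; exact: measurable_funM.
have mi : measurable_fun setT (\1_U : R -> R) by exact: measurable_indic.
have mie := measurable_funM mi me.
have e0 x : 0 <= \1_U x * expR (a * x - a ^+ 2 * s ^+ 2 / 2).
  by rewrite mulr_ge0 ?expR_ge0.
rewrite (ge0_integral_normal _ _ mie e0).
rewrite /normal_prob [RHS]integral_mkcond; apply: eq_integral => x _.
rewrite patchE /= indicE; case: ifPn => _; last by rewrite !mul0r.
rewrite mul1r expRD mulrAC expR_normal_pdf// mulrAC -expRD subrr expR0 mul1r//.
Qed.

(** For y >= 0, y / 2 <= exp(y / 2), and squaring produces the 4. The inequality trades a second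
    moment for two values of the moment generating function. *)
Lemma sqr_le_expR (y : R) : y ^+ 2 <= 4 * (expR y + expR (- y)).
Proof.
wlog y0 : y / 0 <= y => [H|].
  have [/H//|/ltW y0] := leP 0 y.
  by have := H (- y); rewrite oppr_ge0 => /(_ y0); rewrite sqrrN opprK addrC.
have H : 0 <= y / 2 <= expR (y / 2).
  rewrite divr_ge0//=; have := expR_ge1Dx (y / 2); lra.
have -> : expR y = expR (y / 2) ^+ 2 by rewrite expr2 -expRD -splitr.
have := expR_ge0 (- y); nra.
Qed.

Lemma normr_le_expR (y : R) : `|y| <= expR y + expR (- y).
Proof.
have := expR_ge1Dx y; have := expR_ge1Dx (- y).
have := expR_ge0 y; have := expR_ge0 (- y).
by have [y0|y0] := lerP 0 y; [rewrite ger0_norm//|rewrite ltr0_norm//]; lra.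
Qed.

Lemma integrable_normal_expR (s a : R) : s != 0 ->
  (normal_prob 0 s).-integrable setT (EFin \o (fun x : R => expR (a * x))).
Proof.
move=> s0; apply/integrableP; split.
  by apply/measurable_EFinP; exact: measurable_expRM.
under eq_integral do rewrite /= ger0_norm ?expR_ge0//.
by rewrite normal_mgf// ltry.
Qed.

Lemma integrable_normal_id (s : R) : s != 0 ->
  (normal_prob 0 s).-integrable setT (EFin \o (id : R -> R)).
Proof.
move=> s0.
have i1 := integrable_normal_expR 1 s0; have i2 := integrable_normal_expR (-1) s0.
apply: le_integrable (integrableD measurableT i1 i2) => //.
  exact/measurable_EFinP.
move=> x _ /=; rewrite lee_fin mul1r mulN1r.
by rewrite (le_trans (normr_le_expR x))// ler_norm.
Qed.

(** The density is even, so the reflection of the line turns the mean into its opposite. *)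
Lemma Rintegral_normal_id (s : R) : s != 0 -> \int[normal_prob 0 s]_x x = 0.
Proof.
move=> s0.
have mp := @measurable_normal_pdf R 0 s.
have p0 := @normal_pdf_ge0 R 0 s.
have ii := integrable_normal_id s0.
have E1 : \int[lebesgue]_x (normal_pdf 0 s x * x) = \int[normal_prob 0 s]_x x.
  exact: (@Rintegral_weighted _ _ _ _ R lebesgue (normal_prob 0 s) _ id mp p0
    (@measurable_id _ _ setT) (fun U _ => erefl) id (@measurable_id _ _ setT) ii).
have E2 : \int[lebesgue]_x (normal_pdf 0 s x * - x) = \int[normal_prob 0 s]_x x.
  have mo : measurable_fun setT (fun x : R => - x) by exact: measurable_funN.
  apply: (@Rintegral_weighted _ _ _ _ R lebesgue (normal_prob 0 s) _ -%R mp p0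
    mo _ id (@measurable_id _ _ setT) ii) => U mU.
  transitivity (\int[lebesgue]_(x in -%R @^-1` U) (normal_pdf 0 s (- x))%:E)%E;
    last exact: (integral_lebesgue_preserving mo (@lebesgue_measureN R) mU mp p0).
  apply: eq_integral => x _; congr EFin.
  by rewrite !normal_pdfE// /normal_fun !subr0 sqrrN.
have i1 : lebesgue.-integrable setT (EFin \o (fun x => normal_pdf 0 s x * x)).
  exact: (@integrable_weighted _ _ _ _ R lebesgue (normal_prob 0 s) _ id mp p0
    (@measurable_id _ _ setT) (fun U _ => erefl) id (@measurable_id _ _ setT) ii).
apply: eq_opp_eq0.
rewrite -[LHS]E2 -[in RHS]E1 -mulN1r -RintegralZl//.
by apply: eq_Rintegral => x _; rewrite mulrN mulN1r.
Qed.

(** Bounds what clipping at [K + s] removes when the signal is at most [K] in absolute value and the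
    noise is [x]. *)
Definition excess (s x : R) := Num.max (`|x| - s) 0.

Lemma measurable_excess (s : R) : measurable_fun setT (excess s).
Proof.
by apply: measurable_maxr => //; apply: measurable_funB.
Qed.

Lemma excess_ge0 (s x : R) : 0 <= excess s x.
Proof. by rewrite le_max lexx orbT. Qed.

Lemma normal_excess (s : R) : 0 < s ->
  (\int[normal_prob 0 1]_x (excess s x)%:E <=
   (2 / s * expR (- (s ^+ 2 / 2)))%:E)%E.
Proof.
move=> s0.
have n1 : (1 : R) != 0 by exact: oner_neq0.
(* From t <= exp t at t = s (|x| - s), the excess is at most [k] (exp(s x) + exp(-s x)). The rate s
   minimises a^2 / 2 - a s, the exponent that a rate a leaves after integration. *)
pose k := s^-1 * expR (- s ^+ 2).
have k0 : 0 <= k by rewrite mulr_ge0 ?expR_ge0// invr_ge0 ltW.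
have m1 := measurable_expRM s; have m2 := measurable_expRM (- s).
apply: (@le_trans _ _ (\int[normal_prob 0 1]_x
   (k%:E * ((expR (s * x))%:E + (expR (- s * x))%:E)))%E).
  apply: ge0_le_integral => //.
  - by move=> x _; rewrite lee_fin excess_ge0.
  - by apply/measurable_EFinP; exact: measurable_excess.
  - apply/measurable_EFinP; apply: measurable_funM => //.
    exact: measurable_funD.
  move=> x _; rewrite -EFinD -EFinM lee_fin /excess ge_max; apply/andP; split; last first.
    by rewrite mulr_ge0// addr_ge0 ?expR_ge0.
  apply: (@le_trans _ _ (s^-1 * expR (s * (`|x| - s)))).
    rewrite -[leLHS](mulKf (lt0r_neq0 s0)) ler_pM2l ?invr_gt0//.
    by have := expR_ge1Dx (s * (`|x| - s)); lra.
  rewrite /k -mulrA ler_pM2l ?invr_gt0// mulrBr -expr2 expRD mulrC ler_pM2l ?expR_gt0//.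
  have [x0|x0] := lerP 0 x; first by rewrite ger0_norm// lerDl expR_ge0.
  by rewrite ltr0_norm// mulrN -mulNr lerDr expR_ge0.
rewrite ge0_integralZl//; last 2 first.
- by apply/measurable_EFinP; exact: measurable_funD.
- by move=> x _; rewrite -EFinD lee_fin addr_ge0 ?expR_ge0.
rewrite ge0_integralD//; last 2 first.
- exact/measurable_EFinP.
- exact/measurable_EFinP.
rewrite !normal_mgf// -EFinD -EFinM lee_fin sqrrN expr1n mulr1 /k.
have <- : expR (- s ^+ 2) * expR (s ^+ 2 / 2) = expR (- (s ^+ 2 / 2)).
  by rewrite -expRD; congr expR; lra.
by rewrite le_eqVlt; apply/orP; left; apply/eqP; ring.
Qed.

End normal.

Section gaussian_family.
Context d (T : measurableType d) (R : realType) (P : probability T R).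
Variables (I : finType) (V : I -> {RV P >-> R}) (s : I -> R).
Hypothesis s0 : forall i, s i != 0.
Hypothesis lV : forall i, has_law (V i) (normal_prob 0 (s i)).
Hypothesis iV : mutually_independent P (fun i => V i).

Lemma gaussian_family_mgf (b : I -> R) :
  (\int[P]_x (expR (\sum_i b i * V i x))%:E =
   (expR (\sum_i b i ^+ 2 * s i ^+ 2 / 2))%:E)%E.
Proof.
transitivity (\int[P]_x (\prod_i expR (b i * V i x))%:E)%E.
  by apply: eq_integral => x _; rewrite expR_sum.
rewrite (@ge0_integral_prod_indep _ _ _ P I V (fun i x => expR (b i * x))
  (fun i => expR (b i ^+ 2 * s i ^+ 2 / 2)))//.
- by rewrite expR_sum.
- by move=> i; exact: measurable_expRM.
move=> i; rewrite (@ge0_integral_law _ _ _ P (V i) (normal_prob 0 (s i)) (fun x => expR (b i * x))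
  (lV i) (measurable_expRM _) (fun x => expR_ge0 _)).
exact: normal_mgf.
Qed.

Lemma measurable_linear_combination (b : I -> R) :
  measurable_fun setT (fun x => \sum_i b i * V i x).
Proof. by apply: measurable_sum => i; exact: measurable_funM. Qed.

Lemma gaussian_family_second_moment (b : I -> R) :
  0 < \sum_i b i ^+ 2 * s i ^+ 2 ->
  (\int[P]_x ((\sum_i b i * V i x) ^+ 2)%:E <=
   (8 * expR 2^-1 * \sum_i b i ^+ 2 * s i ^+ 2)%:E)%E.
Proof.
set q := \sum_i _ => q0.
(* Scaled by [t], the combination has moment generating function exp(1/2) at 1 and at -1. With
   [sqr_le_expR] this gives 4 q (2 exp(1/2)), without identifying the law of the combination. *)
pose t := (Num.sqrt q)^-1.
have sq0 : 0 < Num.sqrt q by rewrite sqrtr_gt0.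
have t0 : 0 < t by rewrite invr_gt0.
have tq : t ^+ 2 * q = 1.
  by rewrite /t exprVn sqr_sqrtr ?ltW// mulVf// gt_eqF.
have tqV : t ^- 2 = q by rewrite /t exprVn invrK sqr_sqrtr// ltW.
have mL (c : R) : measurable_fun setT (fun x => expR (\sum_i (c * b i) * V i x)).
  by apply: measurableT_comp => //; exact: measurable_linear_combination.
have mgf (c : R) : c ^+ 2 = t ^+ 2 ->
    (\int[P]_x (expR (\sum_i (c * b i) * V i x))%:E = (expR 2^-1)%:E)%E.
  move=> ct; rewrite gaussian_family_mgf; congr (expR _)%:E.
  transitivity (t ^+ 2 * q / 2); last by rewrite tq mul1r.
  rewrite /q mulr_sumr mulr_suml; apply: eq_bigr => i _.
  by rewrite exprMn ct !mulrA.
apply: (@le_trans _ _ (\int[P]_x ((4 * t ^- 2)%:E *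
   ((expR (\sum_i (t * b i) * V i x))%:E +
    (expR (\sum_i (- t * b i) * V i x))%:E)))%E).
  apply: ge0_le_integral => //.
  - by move=> x _; rewrite lee_fin sqr_ge0.
  - apply/measurable_EFinP; apply: measurable_funX.
    exact: measurable_linear_combination.
  - apply/measurable_EFinP; apply: measurable_funM => //.
    by apply: measurable_funD; exact: mL.
  move=> x _; rewrite -EFinD -EFinM lee_fin.
  have E (c : R) : \sum_i (c * b i) * V i x = c * \sum_i b i * V i x.
    by rewrite mulr_sumr; apply: eq_bigr => i _; rewrite mulrA.
  rewrite !E mulrAC ler_pdivlMr ?exprn_gt0// mulNr -exprMn mulrC.
  exact: sqr_le_expR.
rewrite ge0_integralZl//; last 3 first.
- by apply/measurable_EFinP; apply: measurable_funD; exact: mL.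
- by move=> x _; rewrite -EFinD lee_fin addr_ge0 ?expR_ge0.
- by rewrite lee_fin mulr_ge0// invr_ge0 exprn_ge0// ltW.
rewrite ge0_integralD//; last 2 first.
- by apply/measurable_EFinP; exact: mL.
- by apply/measurable_EFinP; exact: mL.
rewrite !mgf ?sqrrN// -EFinD -EFinM lee_fin tqV -/q.
lra.
Qed.

End gaussian_family.

(** * Wavelet expansions on the unit interval *)

Section finite_sums.
Context d (T : measurableType d) (R : realType).
Variables (mu : {measure set T -> \bar R}) (D : set T).
Hypothesis mD : measurable D.

Lemma integrable_sumr (K : finType) (g : K -> T -> R) :
  (forall k, mu.-integrable D (EFin \o g k)) ->
  mu.-integrable D (EFin \o (fun x => \sum_k g k x)).
Proof.
move=> ig; have := @integrable_sum _ _ _ mu _ mD _ (index_enum K) xpredT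
  (fun k x => (g k x)%:E) (fun k _ => ig k).
by apply: eq_integrable => // x _; rewrite /= sumEFin.
Qed.

Lemma Rintegral_sumr (K : finType) (g : K -> T -> R) :
  (forall k, mu.-integrable D (EFin \o g k)) ->
  \int[mu]_(x in D) (\sum_k g k x) = \sum_k \int[mu]_(x in D) g k x.
Proof.
move=> ig; apply: EFin_inj; rewrite fineK; last first.
  exact: (integrable_fin_num mD (integrable_sumr ig)).
under eq_integral do rewrite -sumEFin.
rewrite (@integral_sum _ _ _ mu _ mD _ _ (fun k => ig k)) -sumEFin.
by apply: eq_bigr => k _; rewrite fineK//; exact: (integrable_fin_num mD (ig k)).
Qed.

Lemma integrableZr_EFin (c : R) (g : T -> R) : mu.-integrable D (EFin \o g) ->
  mu.-integrable D (EFin \o (fun x => c * g x)).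
Proof. by move=> ig; have := integrableZl mD c ig; apply: eq_integrable. Qed.

Lemma integrableD_EFin (g h : T -> R) : mu.-integrable D (EFin \o g) ->
  mu.-integrable D (EFin \o h) -> mu.-integrable D (EFin \o (fun x => g x + h x)).
Proof. by move=> ig ih; have := integrableD mD ig ih; apply: eq_integrable. Qed.

Lemma integrableB_EFin (g h : T -> R) : mu.-integrable D (EFin \o g) ->
  mu.-integrable D (EFin \o h) -> mu.-integrable D (EFin \o (fun x => g x - h x)).
Proof. by move=> ig ih; have := integrableB mD ig ih; apply: eq_integrable. Qed.

End finite_sums.

Section unit_interval.
Context (R : realType).
Local Notation lebesgue := (@lebesgue_measure R).
Local Notation I01 := (@unit_itv R).

Lemma measurable_unit_itv : measurable (I01 : set (measurableTypeR R)).
Proof. exact: measurable_itv. Qed.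

Lemma lebesgue_unit_itv : lebesgue I01 = 1%E.
Proof. by rewrite lebesgue_measure_itv/= lte_fin ltr01 oppr0 adde0. Qed.

Definition bounded_on01 (g : R -> R) : Prop :=
  exists M : R, forall x, I01 x -> `|g x| <= M.

Lemma continuous_bounded_on01 (g : R -> R) : continuous g -> bounded_on01 g.
Proof.
move=> cg.
have [M [_ HM]] := @compact_bounded R R (g @` I01)
  (continuous_compact (continuous_subspaceT cg) (@segment_compact R 0 1)).
exists (M + 1) => x Ix; apply: HM; first by rewrite ltrDl.
by exists x.
Qed.

Lemma integrable_bounded_on01 (g : R -> R) : measurable_fun I01 g ->
  bounded_on01 g -> lebesgue.-integrable I01 (EFin \o g).
Proof.
move=> mg [M HM]; apply: measurable_bounded_integrable => //.
- exact: measurable_unit_itv.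
- apply: (le_lt_trans _ (ltry 1)).
  by move: lebesgue_unit_itv => /eqP; rewrite eq_le => /andP[].
exists M; split; first exact: num_real.
by move=> M' MM' x Ix; exact: (le_trans (HM x Ix) (ltW MM')).
Qed.

Lemma L2_01_integrable_sqr (f : R -> R) : L2_01 f ->
  lebesgue.-integrable I01 (EFin \o (fun x => f x ^+ 2)).
Proof.
move=> [mf foo]; apply/integrableP; split.
  by apply/measurable_EFinP; exact: measurable_funX.
rewrite (le_lt_trans _ foo)// /sq_dist01 le_eqVlt; apply/orP; left; apply/eqP.
by apply: eq_integral => x _; rewrite /= subr0 ger0_norm ?sqr_ge0.
Qed.

Lemma L2_01_integrableM (f g : R -> R) : L2_01 f -> measurable_fun I01 g ->
  bounded_on01 g -> lebesgue.-integrable I01 (EFin \o (fun x => f x * g x)).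
Proof.
move=> hf mg [M HM].
have iff_ := L2_01_integrable_sqr hf.
have i1 : lebesgue.-integrable I01 (EFin \o cst 1).
  apply: integrable_bounded_on01; first exact: measurable_cst.
  by exists 1 => x _; rewrite /= normr1.
have i2 := integrableZl measurable_unit_itv M (integrableD measurable_unit_itv i1 iff_).
apply: le_integrable i2 => //.
- exact: measurable_unit_itv.
- by apply/measurable_EFinP; apply: measurable_funM => //; case: hf.
move=> x Ix; rewrite /= lee_fin normrM.
have M0 : 0 <= M by rewrite (le_trans _ (HM x Ix)).
rewrite normrM mulrC (ger0_norm M0) ler_pM// ?HM//.
rewrite [leRHS]ger0_norm ?addr_ge0 ?sqr_ge0//.
rewrite -real_normK ?num_real//; have := sqr_ge0 (`|f x| - 1); nra.
Qed.

End unit_interval.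

Section parseval.
Context (R : realType) (J : finType) (phi : J -> R -> R) (f : R -> R).
Local Notation lebesgue := (@lebesgue_measure R).
Local Notation I01 := (@unit_itv R).
Hypothesis mphi : forall i, measurable_fun I01 (phi i).
Hypothesis bphi : forall i, bounded_on01 (phi i).
Hypothesis ophi : forall i j, inner01 (phi i) (phi j) = (i == j)%:R.
Hypothesis hf : L2_01 f.

Let mI : measurable (I01 : set (measurableTypeR R)) := @measurable_unit_itv R.

Lemma bounded_on01M (g h : R -> R) :
  bounded_on01 g -> bounded_on01 h -> bounded_on01 (fun x => g x * h x).
Proof.
move=> [M HM] [K HK]; exists (M * K) => x Ix.
by rewrite normrM ler_pM// ?HM ?HK.
Qed.

(** Pythagoras in finite form: the integral of f^2 minus the energy of the family is the squared
    distance from [f] to its span, and the coefficient errors add to it. *)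
Lemma sq_dist01_expansion (a : J -> R) :
  sq_dist01 (fun x => \sum_i a i * phi i x) f =
  (\int[lebesgue]_(x in I01) (f x ^+ 2)
    - \sum_i inner01 f (phi i) ^+ 2
    + \sum_i (a i - inner01 f (phi i)) ^+ 2)%:E.
Proof.
have iff_ := L2_01_integrable_sqr hf.
have ifp i : lebesgue.-integrable I01 (EFin \o (fun x => f x * phi i x)).
  exact: L2_01_integrableM.
have ipp i j : lebesgue.-integrable I01 (EFin \o (fun x => phi i x * phi j x)).
  apply: integrable_bounded_on01; first exact: measurable_funM.
  exact: bounded_on01M.
have iZ := integrableZr_EFin mI; have iD := integrableD_EFin mI.
pose F x := \sum_i \sum_j (a i * a j) * (phi i x * phi j x)
  + (\sum_i (-2 * a i) * (f x * phi i x) + f x ^+ 2).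
have FE x : (\sum_i a i * phi i x - f x) ^+ 2 = F x.
  rewrite sqrrB /F addrAC -addrA; congr (_ + _).
    rewrite expr2 mulr_suml; apply: eq_bigr => i _.
    by rewrite mulr_sumr; apply: eq_bigr => j _; ring.
  have -> : f x ^+ 2 - (\sum_i a i * phi i x) * f x *+ 2 =
      (-2 * f x) * (\sum_i a i * phi i x) + f x ^+ 2 by ring.
  by rewrite mulr_sumr; congr (_ + _); apply: eq_bigr => i _; ring.
have i1 : lebesgue.-integrable I01 (EFin \o
    (fun x => \sum_i \sum_j (a i * a j) * (phi i x * phi j x))).
  by do 2 (apply: (integrable_sumr mI) => ?); exact: iZ.
have i2 : lebesgue.-integrable I01 (EFin \o
    (fun x => \sum_i (-2 * a i) * (f x * phi i x))).
  by apply: (integrable_sumr mI) => ?; exact: iZ.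
have iF : lebesgue.-integrable I01 (EFin \o F) by apply: (iD) => //; exact: iD.
rewrite /sq_dist01.
transitivity (\int[lebesgue]_(x in I01) (F x))%:E.
  rewrite /Rintegral fineK; last exact: (integrable_fin_num mI iF).
  by apply: eq_integral => x _; rewrite FE.
congr EFin; rewrite RintegralD//; last exact: iD.
rewrite RintegralD// (Rintegral_sumr mI); last first.
  by move=> ?; apply: (integrable_sumr mI) => ?; exact: iZ.
rewrite (Rintegral_sumr mI); last by move=> ?; exact: iZ.
under eq_bigr => i _.
  rewrite (Rintegral_sumr mI); last by move=> ?; exact: iZ.
  rewrite (bigD1 i)//= big1 ?addr0; last first.
    move=> j ji; rewrite RintegralZl//.
    by have := ophi i j; rewrite /inner01 eq_sym (negbTE ji) => ->; rewrite mulr0.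
  rewrite RintegralZl//.
  have := ophi i i; rewrite /inner01 eqxx => ->; rewrite mulr1.
  over.
under [X in _ + (X + _)]eq_bigr do rewrite RintegralZl//.
rewrite addrA addrC -addrA; congr (_ + _).
rewrite -sumrN -!big_split/=; apply: eq_bigr => i _.
by rewrite -/(inner01 f (phi i)); ring.
Qed.

End parseval.

(** * Comparison of l^2 and l^p norms of finite sequences *)

Section power_mean.
Context (R : realType).

Lemma powR_le_affine (t y : R) : 0 <= t <= 1 -> 0 <= y ->
  y `^ t <= t * y + (1 - t).
Proof.
move=> /andP[t0 t1]; rewrite le_eqVlt => /predU1P[<-|y0].
  rewrite mulr0 add0r; have [->|tn0] := eqVneq t 0; first by rewrite powRr0 subr0.
  by rewrite powR0// subr_ge0.
rewrite -[in leRHS](lnK (y0 : y \is Num.pos)) /powR gt_eqF//.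
set z := ln y; have e0 := expR_gt0 (t * z).
(* [h1] and [h2] compare exp with its tangent at t z, at the points z and 0. Mixed with weights t
   and 1 - t, their linear terms cancel. *)
have h1 : expR (t * z) * (1 + (z - t * z)) <= expR z.
  have -> : expR z = expR (t * z) * expR (z - t * z).
    by rewrite -expRD; congr expR; ring.
  by rewrite ler_pM2l// expR_ge1Dx.
have h2 : expR (t * z) * (1 - t * z) <= 1.
  have E1 : expR (t * z) * expR (- (t * z)) = 1 by rewrite -expRD subrr expR0.
  by rewrite -[leRHS]E1 ler_pM2l// expR_ge1Dx.
have h3 : t * (expR (t * z) * (1 + (z - t * z))) <= t * expR z by rewrite ler_wpM2l.
have h4 : (1 - t) * (expR (t * z) * (1 - t * z)) <= (1 - t) * 1.
  by rewrite ler_wpM2l// subr_ge0.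
apply: le_trans (lerD h3 (le_trans h4 (_ : _ <= 1 - t))); last by rewrite mulr1.
by rewrite le_eqVlt; apply/orP; left; apply/eqP; ring.
Qed.

Lemma sum_sqr_le_lnorm (p : \bar R) (n : nat) (a : 'I_n -> R) :
  (2%:E <= p)%E -> (0 < n)%N ->
  \sum_(k < n) a k ^+ 2 <= n%:R `^ (1 - 2 * einv p) * lnorm p a ^+ 2.
Proof.
move=> p2 n0; have nR : 0 < n%:R :> R by rewrite ltr0n.
case: p p2 => [r| |]//=; last first.
  move=> _; rewrite mulr0 subr0 powRr1 ?ler0n//.
  set M := \big[Num.max/0]_(k < n) _.
  rewrite mulr_natl [leRHS](_ : _ = \sum_(k < n) M ^+ 2); last by rewrite sumr_const card_ord.
  apply: ler_sum => k _.
  rewrite -[leLHS]real_normK ?num_real// lerXn2r ?nnegrE//.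
    by apply: le_trans (le_bigmax _ _ k).
  exact: (le_bigmax _ (fun k => `|a k|) k).
rewrite lee_fin => r2; have r0 : 0 < r by lra.
set S := \sum_(k < n) `|a k| `^ r.
have S0 : 0 <= S by apply: sumr_ge0 => k _; exact: powR_ge0.
have [S_eq0|Sn0] := eqVneq S 0.
  rewrite S_eq0 big1 ?mulr_ge0 ?powR_ge0 ?sqr_ge0// => k _.
  have /eqP := S_eq0; rewrite psumr_eq0; last by move=> *; exact: powR_ge0.
  move=> /allP/(_ k (mem_index_enum _))/= /eqP/eqP.
  rewrite powR_eq0 normr_eq0 => /andP[/eqP -> _]; by rewrite expr0n.
have Sp : 0 < S by rewrite lt_neqAle eq_sym Sn0.
pose t := 2 / r.
have t01 : 0 <= t <= 1.
  rewrite /t divr_ge0 ?(ltW r0)//= ler_pdivrMr// mul1r//.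
have SnE : (S / n%:R) `^ t * n%:R = n%:R `^ (1 - t) * (S `^ r^-1) ^+ 2.
  rewrite powRM ?invr_ge0 ?(ltW nR)//.
  have -> : (S `^ r^-1) ^+ 2 = S `^ t.
    by rewrite -powR_mulrn ?powR_ge0// -powRrM mulrC.
  rewrite -powR_inv1 ?(ltW nR)// -powRrM mulN1r -[X in _ * X = _]powRr1 ?(ltW nR)//.
  by rewrite -mulrA -powRD ?(gt_eqF nR) ?implybT// mulrC addrC.
rewrite -SnE.
(* the tangent of the concave function [y `^ t] at the mean of [`|a k| `^ r] *)
have step k : a k ^+ 2 <= (S / n%:R) `^ t * (t * (`|a k| `^ r * n%:R / S) + (1 - t)).
  have y0 : 0 <= `|a k| `^ r * n%:R / S.
    by rewrite divr_ge0// mulr_ge0 ?powR_ge0// ltW.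
  apply: (@le_trans _ _ ((S / n%:R) `^ t * (`|a k| `^ r * n%:R / S) `^ t)); last first.
    by rewrite ler_wpM2l ?powR_ge0//; exact: powR_le_affine.
  rewrite -powRM ?divr_ge0 ?(ltW nR)//.
  rewrite (_ : S / n%:R * _ = `|a k| `^ r); last first.
    by field; rewrite Sn0 gt_eqF.
  rewrite -powRrM /t mulrC divfK ?gt_eqF// powR_mulrn ?normr_ge0//.
  by rewrite real_normK ?num_real.
apply: (le_trans (ler_sum _ (fun k _ => step k))).
rewrite -mulr_sumr ler_wpM2l ?powR_ge0// big_split/= sumr_const card_ord.
rewrite -mulr_sumr -!mulr_suml -/S.
rewrite le_eqVlt; apply/orP; left; apply/eqP; rewrite -mulr_natr.
by field.
Qed.

End power_mean.

(** * Continuity, counting and positivity for the wavelet basis *)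

Section wavelets.
Context (R : realType) (A : nat) (B : cdv_basis R A).
Local Notation I01 := (@unit_itv R).
Local Notation lebesgue := (@lebesgue_measure R).

Lemma classC_continuous (g : R -> R) : classC A g -> continuous g.
Proof. by move=> [_ /(_ 0%N isT)]. Qed.

Lemma nwaveE l : (lev0 B < l)%N -> nwave B l = (2 ^ l)%N.
Proof. by move=> h; rewrite /nwave ltnNge (ltnW h)/= gtn_eqF. Qed.

(** Values of [wave] off [0,1] are arbitrary, so regularity has to come from a continuous function
    on the line that agrees with it on the interval. The father, left, interior and right
    descriptions each supply one. *)
Lemma wave_continuous l k : (k < nwave B l)%N ->
  exists2 g : R -> R, continuous g & forall x, I01 x -> wave B l k x = g x.
Proof.
rewrite /nwave; case: (ltnP l (lev0 B)) => // l0l; have [->|ll0] := eqVneq l (lev0 B) => kn.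
  exists (wave B (lev0 B) k) => //.
  exact/classC_continuous/father_classC.
have {l0l ll0} ll0 : (lev0 B < l)%N by rewrite ltn_neqAle eq_sym ll0.
have cZ (c : R) (g : R -> R) : continuous g -> continuous (fun x => c * g x).
  by move=> cg x; apply: cvgM; [exact: cvg_cst|exact: cg].
have cL (f g : R -> R) : continuous f -> continuous g -> continuous (g \o f).
  by move=> cf cg x; apply: continuous_comp; [exact: cf|exact: cg].
have cM : continuous (fun x : R => 2 ^+ l * x) by apply: cZ => x; exact: cvg_id.
have [kl|kl] := ltnP k (bdry B).
  exists (fun x => 2 `^ (l%:R / 2) * bleft B k (2 ^+ l * x)).
    apply: cZ; apply: (cL _ (bleft B k)) => //.
    exact/classC_continuous/bleft_classC.
  by move=> x; exact: wave_left.
have [kr|kr] := ltnP (k + bdry B) (2 ^ l).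
  exists (fun x => 2 `^ (l%:R / 2) * mother B (2 ^+ l * x - k%:R)).
    apply: cZ; apply: (cL (fun x => 2 ^+ l * x - k%:R) (mother B)).
      by move=> x; apply: cvgB; [exact: cM|exact: cvg_cst].
    exact/classC_continuous/mother_classC.
  by move=> x; exact: wave_interior.
(* Position counted from the right end: k = 2^l - (k' + 1) is the index form of [wave_right]. *)
pose k' := (2 ^ l - k.+1)%N.
have k'b : (k' < bdry B)%N by rewrite /k' ltn_subLR// addSn ltnS.
have kE : k = (2 ^ l - k'.+1)%N.
  by rewrite /k' subnSK// subKn// ltnW.
exists (fun x => 2 `^ (l%:R / 2) * bright B k' (2 ^+ l * (1 - x))).
  apply: (cZ); apply: (cL (fun x => 2 ^+ l * (1 - x)) (bright B k')).
    apply: (cZ) => x; apply: cvgB; [exact: cvg_cst|exact: cvg_id].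
  exact/classC_continuous/bright_classC.
by move=> x Ix; rewrite [in LHS]kE; exact: wave_right.
Qed.

Lemma measurable_wave l k : (k < nwave B l)%N -> measurable_fun I01 (wave B l k).
Proof.
move=> /wave_continuous[g cg E].
apply: (eq_measurable_fun g) => [x /[!inE] Ix|]; first by rewrite E.
apply: measurable_funTS; exact: continuous_measurable_fun.
Qed.

Lemma bounded_wave l k : (k < nwave B l)%N -> bounded_on01 (wave B l k).
Proof.
move=> /wave_continuous[g cg E]; have [M HM] := continuous_bounded_on01 cg.
by exists M => x Ix; rewrite E//; exact: HM.
Qed.

Lemma measurable_cwave L (c : coefs B L) : measurable_fun I01 (cwave c).
Proof. exact: measurable_wave. Qed.

Lemma bounded_cwave L (c : coefs B L) : bounded_on01 (cwave c).
Proof. exact: bounded_wave. Qed.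

Lemma inner01_cwave L (c c' : coefs B L) :
  inner01 (cwave c) (cwave c') = (c == c')%:R.
Proof.
rewrite /cwave Defs.orthonormal//; congr (_%:R); congr nat_of_bool.
case: c c' => [l k] [l' k'] /=.
apply/andP/eqP => [[/eqP/val_inj ll' /eqP kk']|].
  by subst l'; congr existT; apply/val_inj.
by move=> /eqP; rewrite -tag_eqE /tag_eq/= => /andP[/eqP ll']; subst l';
  rewrite tagged_asE => /eqP ->.
Qed.

Lemma sum_coefs (V : nmodType) L (F : nat -> nat -> V) :
  \sum_(c : coefs B L) F (tag c) (tagged c) =
  \sum_(l < L.+1) \sum_(k < nwave B l) F l k.
Proof. by rewrite sig_big_dep. Qed.

Lemma sum_pow2 L : (\sum_(l < L) 2 ^ l < 2 ^ L)%N.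
Proof. by elim: L => [|L IH]; rewrite ?big_ord0// big_ord_recr/= expnS mul2n -addnn ltn_add2r. Qed.

Lemma nwave_le l : (nwave B l <= (if l == lev0 B then nfather B else 0) + 2 ^ l)%N.
Proof.
rewrite /nwave; case: ltnP => // _; case: eqP => // _; exact: leq_addr.
Qed.

(** The father level accounts for [nfather B], and 1 + 2 + ... + 2^L < 2^(L+1) for the 2. *)
Lemma card_coefs L : (#|{: coefs B L}| <= (nfather B + 2) * 2 ^ L)%N.
Proof.
rewrite card_tagged sumnE big_map big_enum/=.
under eq_bigr do rewrite card_ord.
apply: (@leq_trans (\sum_(l < L.+1) ((if (l : nat) == lev0 B then nfather B else 0) + 2 ^ l))).
  by apply: leq_sum => l _; exact: nwave_le.
rewrite big_split/= mulnDl leq_add//; last first.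
  by rewrite mulnC -expnSr ltnW// sum_pow2.
apply: (@leq_trans (nfather B)); last by rewrite leq_pmulr// expn_gt0.
rewrite -big_mkcond/= sum_nat_const.
rewrite -[leqRHS]mul1n leq_mul2r; apply/orP; right.
apply/card_le1_eqP => i j /eqnP il /eqnP jl.
by apply/val_inj; exact: etrans jl (esym il).
Qed.

(** [sup] is an upper bound only for a set known to be bounded. Boundedness holds because the mother
    wavelet is continuous and vanishes off a compact interval. *)
Lemma mother_bounded x : `|mother B x| <= mother_sup B.
Proof.
have cm : continuous (mother B) by exact/classC_continuous/mother_classC.
have [M [_ HM]] := @compact_bounded R R (mother B @` `[- Defs.radius B, Defs.radius B])
  (continuous_compact (continuous_subspaceT cm) (@segment_compact R _ _)).
apply: sup_upper_bound; last by exists x.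
split; first by exists `|mother B 0|, 0.
exists (Num.max 0 (M + 1)) => _ [y _ <-].
have [->|my] := eqVneq (mother B y) 0; first by rewrite normr0 le_max lexx.
rewrite le_max; apply/orP; right; apply: HM; first by rewrite ltrDl.
by exists y => //=; rewrite in_itv/= -ler_norml mother_supp.
Qed.

(** A function of norm one cannot vanish on the whole interval. *)
Lemma wave_neq0 l k : (k < nwave B l)%N ->
  exists2 x, I01 x & wave B l k x != 0.
Proof.
move=> kn; apply: contrapT => H.
have := @Defs.orthonormal _ _ B l k l k kn kn; rewrite !eqxx/= /inner01.
rewrite (@eq_Rintegral _ _ _ _ _ (fun=> 0)).
  by rewrite Rintegral_cst ?mul0r; [move/esym/eqP; rewrite oner_eq0|exact: measurable_unit_itv].
move=> x /[!inE] Ix; have [->|w0] := eqVneq (wave B l k x) 0; first by rewrite mulr0.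
by exfalso; apply: H; exists x.
Qed.

Lemma mother_sup_gt0 : 0 < mother_sup B.
Proof.
(* [bdry_small] lets the boundary wavelets fill level lev0 + 1 completely. One level higher the
   index [bdry B] is certainly interior, and the wavelet there is a dilate of the mother that is not
   identically zero. *)
pose l := (lev0 B).+2; pose k := bdry B.
have kl : (k + bdry B < 2 ^ l)%N.
  rewrite /k addnn -mul2n; apply: leq_ltn_trans (bdry_small B) _.
  by rewrite ltn_exp2l.
have l0 : (lev0 B < l)%N by rewrite /l.
have kn : (k < nwave B l)%N.
  rewrite nwaveE//.
  by rewrite (leq_ltn_trans _ kl)// leq_addr.
have [x Ix wx] := wave_neq0 kn.
rewrite lt_neqAle (le_trans (normr_ge0 _) (mother_bounded 0)) andbT eq_sym.
apply: contra_neq wx => m0; rewrite wave_interior//.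
have := mother_bounded (2 ^+ l * x - k%:R); rewrite m0 normr_le0 => /eqP ->.
by rewrite mulr0.
Qed.

Lemma wsuppP l k x : I01 x -> wave B l k x != 0 -> wsupp B l k x.
Proof. by move=> Ix wx; apply: subset_closure. Qed.

Lemma cA_gt0 : 0 < cA B.
Proof.
pose l := (lev0 B).+1.
have kn : (0 < nwave B l)%N.
  by rewrite nwaveE// expn_gt0.
have [x Ix wx] := wave_neq0 kn.
apply: lt_le_trans (overlap B l Ix); rewrite ltr0n; apply/card_gt0P.
exists (Ordinal kn); by rewrite inE; exact: (wsuppP Ix wx).
Qed.

(** Keeps the noise nondegenerate: the density computations for [normal_prob] assume a nonzero
    standard deviation. *)
Lemma noise_var_gt0 L tau n eps delta : 0 < tau -> (0 < n)%N -> 0 < eps ->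
  0 < delta <= 1 -> 0 < noise_var B L tau n eps delta.
Proof.
move=> t0 n0 e0 /andP[d0 d1].
have c0 : 0 < c_psi B.
  by rewrite /c_psi !mulr_gt0// ?sqrtr_gt0 ?cA_gt0 ?mother_sup_gt0.
have l0 : 0 < ln (2 / delta).
  by rewrite ln_gt0// ltr_pdivlMr// mul1r (le_lt_trans d1)// ltr1n.
rewrite /noise_var divr_gt0//; last by rewrite mulr_gt0// exprn_gt0// ltr0n.
by do ! apply: mulr_gt0 => //; rewrite exprn_gt0.
Qed.

End wavelets.

(** * Decay of the wavelet energy over the Besov ball *)

Section approximation.
Context (R : realType) (A : nat) (B : cdv_basis R A).
Local Notation I01 := (@unit_itv R).
Local Notation lebesgue := (@lebesgue_measure R).
Variables (alpha rad : R) (p q : \bar R).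
Hypothesis hp : (2%:E <= p)%E.
Hypothesis hq : (1%:E <= q)%E.
Hypothesis halpha : 2^-1 < alpha - einv p.
Variable f : R -> R.
Hypothesis hf : besov_ball B alpha p q rad f.

Lemma lnorm_ge0 n (a : 'I_n -> R) : 0 <= lnorm p a.
Proof.
rewrite /lnorm; case: p => [r| |]; first exact: powR_ge0.
  by elim/big_ind: _ => // x y x0 y0; rewrite le_max x0.
by elim/big_ind: _ => // x y x0 y0; rewrite le_max x0.
Qed.

Lemma besov_level_ge0 l : 0 <= besov_level B alpha p f l.
Proof. by rewrite /besov_level mulr_ge0 ?powR_ge0 ?lnorm_ge0. Qed.

(** A single term is at most the l^q norm of the sequence, so every [q] leads to the same level-wise
    bound. *)
Lemma besov_level_le l : (lev0 B <= l)%N -> besov_level B alpha p f l <= rad.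
Proof.
move=> ll0; have [_] := hf; rewrite /besov_norm.
case: q hq => [r| |]//; last first.
  move=> _ H; rewrite -lee_fin (le_trans _ H)//; apply: ereal_sup_ubound.
  by exists l.
rewrite lee_fin => r1 H; have r0 : 0 < r by rewrite (lt_le_trans _ r1).
rewrite -lee_fin (le_trans _ H)//.
set S := (\sum_(_ <= _ <oo) _)%E in H *.
have lS : ((besov_level B alpha p f l `^ r)%:E <= S)%E.
  have g0 i : (0 <= (besov_level B alpha p f i `^ r)%:E)%E by rewrite lee_fin powR_ge0.
  apply: le_trans (nneseries_lim_ge l.+1 _); last by move=> *; exact: g0.
  rewrite big_nat_recr//=.
  by rewrite leeDr// sume_ge0.
rewrite -[leLHS]/((besov_level B alpha p f l)%:E).
have -> : (besov_level B alpha p f l)%:E =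
    poweR (besov_level B alpha p f l `^ r)%:E r^-1.
  by rewrite poweR_EFin -powRrM mulfV ?gt_eqF// powRr1// besov_level_ge0.
apply: gt0_ler_poweR => //; rewrite ?in_itv/= ?leey ?andbT.
- by rewrite invr_ge0 ltW.
- by rewrite lee_fin powR_ge0.
- by rewrite (le_trans _ lS)// lee_fin powR_ge0.
Qed.

Definition energy J := \sum_(l < J) \sum_(k < nwave B l) inner01 f (wave B l k) ^+ 2.

Let x := 2 `^ (- (2 * alpha)) : R.

Lemma einv_ge0 : 0 <= einv p.
Proof.
rewrite /einv; case: p hp => [r| |]// ; rewrite lee_fin invr_ge0 => r2.
by rewrite (le_trans _ r2).
Qed.

(** alpha > 1/2 + 1/p >= 1/2. A decay ratio of at most 1/2 makes the geometric tail beyond L cost no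
    more than x^L, with constant 1. *)
Lemma decay_le_half : 0 < x <= 2^-1.
Proof.
rewrite /x powR_gt0//= -powR_inv1// ler_powR// ?ler1n//.
have := einv_ge0; have := halpha; lra.
Qed.

Lemma level_energy l : (lev0 B < l)%N ->
  \sum_(k < nwave B l) inner01 f (wave B l k) ^+ 2 <= rad ^+ 2 * x ^+ l.
Proof.
move=> ll0.
have nE := nwaveE ll0.
have n0 : (0 < nwave B l)%N by rewrite nE expn_gt0.
apply: (le_trans (sum_sqr_le_lnorm _ hp n0)).
have := besov_level_le (ltnW ll0).
have := besov_level_ge0 l; rewrite /besov_level.
set T := lnorm _ _ => T0 Tr.
set w := 2 `^ _ in T0 Tr.
have w0 : 0 < w by rewrite /w powR_gt0.
(* Exponent count: 2 (alpha + 1/2 - 1/p) - 2 alpha = 1 - 2/p. *)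
have -> : (nwave B l)%:R `^ (1 - 2 * einv p) = w ^+ 2 * x ^+ l :> R.
  rewrite nE natrX -[2 ^+ l]powR_mulrn// /w /x -powR_mulrn ?powR_ge0//.
  rewrite -[X in _ = _ * X]powR_mulrn ?powR_ge0// -!powRrM -powRD; last first.
    by rewrite pnatr_eq0 implybT.
  by congr powR; field.
rewrite mulrAC -exprMn ler_wpM2r// ?exprn_ge0//.
  by have /andP[/ltW] := decay_le_half.
by rewrite lerXn2r// ?nnegrE// (le_trans T0).
Qed.

(** As x <= 1/2, the next level costs x^(L+j+1) <= x^(L+j) - x^(L+j+1). The increments telescope,
    and the resulting bound survives the limit in [j]. *)
Lemma energy_increment L j : (lev0 B <= L)%N ->
  energy (L.+1 + j) <= energy L.+1 + rad ^+ 2 * (x ^+ L - x ^+ (L + j)).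
Proof.
move=> lL; elim: j => [|j IH]; first by rewrite !addn0 subrr mulr0 addr0.
rewrite addnS [X in X <= _]/energy big_ord_recr/= -/(energy _).
have ll : (lev0 B < L.+1 + j)%N by rewrite (leq_trans (_ : lev0 B < L.+1)%N)// leq_addr.
have h := level_energy ll.
apply: le_trans (lerD IH h) _.
rewrite -addrA lerD2l -mulrDr ler_wpM2l ?sqr_ge0//.
rewrite addSn addnS exprS.
have /andP[x0 x1] := decay_le_half.
have : 0 <= x ^+ (L + j) by rewrite exprn_ge0// ltW.
nra.
Qed.

Lemma sq_dist01C (g h : R -> R) : sq_dist01 g h = sq_dist01 h g.
Proof. by apply: eq_integral => y _; rewrite -sqrrN opprB. Qed.

Lemma sq_dist01_coefs L (a : coefs B L -> R) :
  sq_dist01 (fun y => \sum_(c : coefs B L) a c * cwave c y) f =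
  (\int[lebesgue]_(y in I01) (f y ^+ 2) - energy L.+1
    + \sum_(c : coefs B L) (a c - inner01 f (cwave c)) ^+ 2)%:E.
Proof.
have [f2 _] := hf.
rewrite (sq_dist01_expansion (@measurable_cwave _ _ B L) (@bounded_cwave _ _ B L)
  (@inner01_cwave _ _ B L) f2).
congr ((_ - _ + _)%:E).
by rewrite (@sum_coefs _ _ B _ L (fun l k => inner01 f (wave B l k) ^+ 2)).
Qed.

(** For the exact coefficients the expansion of the squared distance leaves only this defect, so
    completeness of the basis is its convergence to 0. *)
Lemma energy_cvg :
  (fun J => \int[lebesgue]_(y in I01) (f y ^+ 2) - energy J.+1) @ \oo --> (0 : R).
Proof.
have [f2 _] := hf; have := complete B f2.
(* [complete] sums over the levels below its index, whereas [coefs B J] includes level [J]. *)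
rewrite -cvg_shiftS/= => H.
set u := (X in X @ \oo --> _).
suff : EFin \o u @ \oo --> 0%E by move=> /fine_cvgP[_].
apply: cvg_trans H; apply: near_eq_cvg; near=> J.
rewrite /= /u [LHS]sq_dist01C.
have := sq_dist01_coefs (fun c : coefs B J => inner01 f (cwave c)).
rewrite [X in _ - _ + X]big1 ?addr0; last by move=> c _; rewrite subrr expr0n.
move=> <-; congr sq_dist01; apply/funext => y.
by rewrite (@sum_coefs _ _ B _ J (fun l k => inner01 f (wave B l k) * wave B l k y)).
Unshelve. all: by end_near.
Qed.

Lemma approximation_error L : (lev0 B <= L)%N ->
  \int[lebesgue]_(y in I01) (f y ^+ 2) - energy L.+1 <= rad ^+ 2 * x ^+ L.
Proof.
move=> lL; have /andP[x0 _] := decay_le_half.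
set F2 := Rintegral _ _ _.
have bnd j : F2 - energy L.+1 <= (F2 - energy (L + j).+1) + rad ^+ 2 * x ^+ L.
  have := energy_increment j lL; rewrite addSn => h.
  have : 0 <= rad ^+ 2 * x ^+ (L + j) by rewrite mulr_ge0 ?sqr_ge0// exprn_ge0// ltW.
  by move: h; rewrite mulrBr; lra.
have c1 : (fun j => F2 - energy (L + j).+1) @ \oo --> (0 : R).
  have := energy_cvg; rewrite -(cvg_shiftn L) => h.
  by under eq_fun do rewrite addnC.
have c2 : (fun j => F2 - energy (L + j).+1 + rad ^+ 2 * x ^+ L) @ \oo
    --> 0 + rad ^+ 2 * x ^+ L by apply: cvgD => //; exact: cvg_cst.
rewrite -[leRHS]add0r; apply: (ler_cvg_to (cvg_cst _) c2).
by near=> j; exact: bnd.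
Unshelve. all: by end_near.
Qed.

End approximation.

(** * The Gaussian mechanism *)

Section gaussian_shift.
Context d (T : measurableType d) (R : realType) (P : probability T R).
Variables (C : finType) (W : C -> {RV P >-> R}) (s : R).
Hypothesis s0 : s != 0.
Hypothesis lW : forall c, has_law (W c) (normal_prob 0 s).
Hypothesis iW : mutually_independent P (fun c => W c).
Variables (a v : C -> R).

(** Logarithm of the density ratio between the Gaussian vectors centred at [a + v] and at [a],
    evaluated at [a + W]. *)
Definition privacy_loss (w : T) : R :=
  \sum_c (v c / s ^+ 2) * W c w - \sum_c v c ^+ 2 / s ^+ 2 / 2.

Lemma measurable_privacy_loss : measurable_fun setT privacy_loss.
Proof.
apply: measurable_funB => //.
exact: (@measurable_linear_combination _ _ _ P C W (fun c => v c / s ^+ 2)).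
Qed.

(** With V = sum of v_c^2 / s^2, this is the moment generating function of a normal variable with
    mean -V/2 and variance V. At b = 1 it says that the density has total mass 1. *)
Lemma privacy_loss_moment (b : R) :
  (\int[P]_w (expR (b * privacy_loss w))%:E =
   (expR ((b ^+ 2 - b) * (\sum_c v c ^+ 2 / s ^+ 2) / 2))%:E)%E.
Proof.
have E w : expR (b * privacy_loss w) =
    expR (- (b * \sum_c v c ^+ 2 / s ^+ 2 / 2)) *
    expR (\sum_c (b * (v c / s ^+ 2)) * W c w).
  rewrite -expRD; congr expR; rewrite /privacy_loss mulrBr addrC; congr (_ + _).
  rewrite mulr_sumr; apply: eq_bigr => c _; exact: mulrA.
under eq_integral do rewrite E EFinM.
have mL : measurable_fun setT
    (fun w => expR (\sum_c (b * (v c / s ^+ 2)) * W c w)).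
  apply: measurableT_comp => //.
  exact: (@measurable_linear_combination _ _ _ P C W (fun c => b * (v c / s ^+ 2))).
rewrite ge0_integralZl//; last exact/measurable_EFinP.
rewrite (@gaussian_family_mgf _ _ _ P C W (fun=> s) (fun=> s0) lW iW).
rewrite -EFinM -expRD; congr (expR _)%:E.
rewrite (_ : \sum_i (b * (v i / s ^+ 2)) ^+ 2 * s ^+ 2 / 2 =
    b ^+ 2 * (\sum_c v c ^+ 2 / s ^+ 2) / 2); first by rewrite -mulr_suml; ring.
by rewrite mulr_sumr mulr_suml; apply: eq_bigr => c _; field.
Qed.

(** The cylinders that generate [product_sigma] constrain one coordinate each and are not stable
    under intersection; rectangles are, as Dynkin's theorem demands. *)
Definition rectangle : set (set (C -> R)) :=
  [set E | exists U : C -> set R, (forall c, measurable (U c)) /\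
     E = [set t | forall c, U c (t c)]].

Lemma setI_closed_rectangle : setI_closed rectangle.
Proof.
move=> _ _ [U [mU ->]] [U' [mU' ->]]; exists (fun c => U c `&` U' c); split.
  by move=> c; exact: measurableI.
apply/seteqP; split => t /=; first by move=> [h h'] c; split; [exact: h|exact: h'].
by move=> h; split => c; have [] := h c.
Qed.

Lemma product_sigma_rectangle : @product_sigma R C `<=` <<s rectangle >>.
Proof.
apply: smallest_sub; first exact: smallest_sigma_algebra.
move=> _ [c [U [mU ->]]]; apply: sub_gen_smallest.
exists (fun c' => if c' == c then U else setT); split.
  by move=> c'; case: ifP.
apply/seteqP; split => t /=; first by move=> Ut c'; case: eqP => // ->.
by move=> /(_ c); rewrite eqxx.
Qed.

(** Independence splits both sides into one-dimensional factors. In coordinate c the tilt v_c / s^2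
    moves the mean by exactly v_c. *)
Lemma shift_rectangle (U : C -> set R) : (forall c, measurable (U c)) ->
  [/\ measurable [set w | forall c, U c (a c + W c w)],
      measurable [set w | forall c, U c (a c + v c + W c w)] &
   (P [set w | forall c, U c (a c + v c + W c w)%R] =
   \int[P]_(w in [set w | forall c, U c (a c + W c w)%R])
     (expR (privacy_loss w))%:E)%E].
Proof.
move=> mU.
have mW c : measurable_fun setT (W c) by [].
have ma (b : R) : measurable_fun setT (fun x : R => b + x).
  exact: measurable_funD.
have mpre (b : C -> R) c : measurable ((fun x => b c + x) @^-1` U c).
  by apply: measurable_preimage.
have mS (b : C -> R) : measurable [set w | forall c, U c (b c + W c w)].
  rewrite (_ : [set w | _] =
      \bigcap_(c in [set: C]) (W c @^-1` ((fun x => b c + x) @^-1` U c))).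
    apply: fin_bigcap_measurable => // c _.
    exact: (measurable_preimage (mW c) (mpre b c)).
  by apply/seteqP; split => w /= h c; [move=> _|]; exact: h.
split; [exact: mS|exact: (mS (fun c => a c + v c))|].
rewrite (@mutually_independent_prob _ _ _ P C (fun c => W c)
  (fun c => (fun x => a c + v c + x) @^-1` U c) iW); last first.
  exact: (mpre (fun c => a c + v c)).
pose g c (x : R) : R := \1_((fun x => a c + x) @^-1` U c) x *
  expR (v c / s ^+ 2 * x - (v c / s ^+ 2) ^+ 2 * s ^+ 2 / 2).
have mg c : measurable_fun setT (g c).
  apply: measurable_funM; first by apply: measurable_indic; exact: (mpre a).
  by apply: measurableT_comp => //; apply: measurable_funB => //; exact: measurable_funM.
have g0 c x : 0 <= g c x by rewrite mulr_ge0 ?expR_ge0.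
have ge c : (\int[P]_w (g c (W c w))%:E =
    (fine (normal_prob (v c) s ((fun x => a c + x) @^-1` U c)))%:E)%E.
  rewrite (@ge0_integral_law _ _ _ P (W c) (normal_prob 0 s) (g c) (lW c) (mg c) (g0 c)).
  rewrite (normal_tilt _ s0 (mpre a c)) divfK ?expf_neq0//.
  by rewrite fineK// fin_num_measure//; exact: (mpre a).
transitivity (\int[P]_w (\prod_c g c (W c w))%:E)%E.
  rewrite (@ge0_integral_prod_indep _ _ _ P C W g _ iW mg g0 ge).
  rewrite -prodEFin; apply: eq_bigr => c _.
  rewrite fineK; last by apply: fin_num_measure; exact: (mpre a).
  rewrite -(normal_prob_shift _ s0 (mpre a c)).
  transitivity (normal_prob 0 s ((fun x => a c + v c + x) @^-1` U c)).
    by rewrite -(lW c)//; exact: (mpre (fun c => a c + v c)).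
  congr (normal_prob 0 s _); apply/seteqP; split => x /=;
    by rewrite -addrA (addrC (v c)).
rewrite [RHS]integral_mkcond; apply: eq_integral => w _; rewrite patchE.
have [/set_mem H|/negP H] := boolP (w \in _).
  congr EFin; rewrite /privacy_loss -sumrB expR_sum; apply: eq_bigr => c _.
  rewrite /g indicE mem_set ?mul1r; last exact: H.
  by congr (expR (_ - _)); field.
congr EFin; apply/eqP/prodf_eq0; apply: contrapT => H'; apply: H; apply/mem_set => c.
apply: contrapT => nU; apply: H'; exists c => //.
by rewrite /g indicE memNset ?mul0r.
Qed.

(* The Cameron-Martin formula, in finitely many dimensions. *)
Lemma gaussian_shift (E : set (C -> R)) : @product_sigma R C E ->
  [/\ measurable [set w | E (fun c => a c + W c w)],
      measurable [set w | E (fun c => a c + v c + W c w)] &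
   (P [set w | E (fun c => a c + v c + W c w)%R] =
   \int[P]_(w in [set w | E (fun c => a c + W c w)%R])
     (expR (privacy_loss w))%:E)%E].
Proof.
move=> /product_sigma_rectangle.
rewrite -(setI_closed_g_dynkin_g_sigma_algebra setI_closed_rectangle).
have mZ : measurable_fun setT (fun w => (expR (privacy_loss w))%:E).
  by apply/measurable_EFinP; apply: measurableT_comp => //; exact: measurable_privacy_loss.
have Z0 w : (0 <= (expR (privacy_loss w))%:E)%E by rewrite lee_fin expR_ge0.
(* Total mass 1 is what makes the class stable under complements. *)
have Z1 : (\int[P]_w (expR (privacy_loss w))%:E = 1)%E.
  have := privacy_loss_moment 1; rewrite expr1n subrr !mul0r expR0.
  by under eq_integral do rewrite mul1r.
(* [E] is a bare set of functions, so the measurability of its two preimages has to travel with the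
   identity through the induction. *)
pose D := [set E' : set (C -> R) |
  [/\ measurable [set w | E' (fun c => a c + W c w)],
      measurable [set w | E' (fun c => a c + v c + W c w)] &
   (P [set w | E' (fun c => a c + v c + W c w)%R] =
   \int[P]_(w in [set w | E' (fun c => a c + W c w)%R])
     (expR (privacy_loss w))%:E)%E]].
suff : <<d rectangle >> `<=` D by apply.
apply: smallest_sub; last by move=> _ [U [mU ->]]; exact: shift_rectangle.
split.
- split; [exact: measurableT|exact: measurableT|].
  by rewrite Z1 probability_setT.
- move=> S [m1 m2 e].
  split; [exact: (measurableC m1)|exact: (measurableC m2)|].
  change (P (~` [set w | S (fun c => a c + v c + W c w)%R]) =
    \int[P]_(w in ~` [set w | S (fun c => a c + W c w)%R])
      (expR (privacy_loss w))%:E)%E.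
  rewrite probability_setC// e.
  have fi : (\int[P]_(w in [set w | S (fun c => a c + W c w)%R])
      (expR (privacy_loss w))%:E \is a fin_num)%E.
    by rewrite -e fin_num_measure.
  have <- : (\int[P]_(w in [set w | S (fun c => a c + W c w)%R]) (expR (privacy_loss w))%:E +
      \int[P]_(w in ~` [set w | S (fun c => a c + W c w)%R]) (expR (privacy_loss w))%:E = 1)%E.
    rewrite -ge0_integral_setU//.
    + by rewrite setUv.
    + exact: measurableC.
    + by rewrite setUv.
    + by apply/disj_setPS => w [].
  by rewrite addeAC subee// add0e.
- move=> F tF HF.
  have m1 k : measurable [set w | F k (fun c => a c + W c w)] by have [] := HF k.
  have m2 k : measurable [set w | F k (fun c => a c + v c + W c w)] by have [] := HF k.
  split; [exact: (bigcup_measurable (fun k _ => m1 k))|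
    exact: (bigcup_measurable (fun k _ => m2 k))|].
  change (P (\bigcup_k [set w | F k (fun c => a c + v c + W c w)%R]) =
    \int[P]_(w in \bigcup_k [set w | F k (fun c => a c + W c w)%R])
      (expR (privacy_loss w))%:E)%E.
  rewrite measure_semi_bigcup//; last 2 first.
  + by move=> i j _ _ [w [Fi Fj]]; apply: tF => //; exists (fun c => a c + v c + W c w).
  + exact: bigcup_measurable.
  rewrite ge0_integral_bigcup//; last 2 first.
  + exact: measurable_funTS.
  + by move=> i j _ _ [w [Fi Fj]]; apply: tF => //; exists (fun c => a c + W c w).
  by apply: eq_eseriesr => k _; have [] := HF k.
Qed.

Lemma gaussian_mechanism (eps delta : R) (E : set (C -> R)) :
  0 < eps -> 0 < delta <= 1 -> eps <= 2 * ln (2 / delta) ->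
  4 * ln (2 / delta) * (\sum_c v c ^+ 2 / s ^+ 2) <= eps ^+ 2 ->
  @product_sigma R C E ->
  (P [set w | E (fun c => a c + v c + W c w)%R] <=
   (expR eps)%:E * P [set w | E (fun c => a c + W c w)%R] + delta%:E)%E.
Proof.
move=> e0 /andP[d0 d1] el hV mE; set lam := ln (2 / delta) in el hV.
have lam0 : 0 < lam by rewrite ln_gt0// ltr_pdivlMr// mul1r (le_lt_trans d1)// ltr1n.
have [mS _ ->] := gaussian_shift mE.
set S := [set w | _] in mS *.
(* Chernoff: with [l := privacy_loss w], the density [expR l] is at most
   [expR eps + expR (- (k * eps)) * expR ((1 + k) * l)] for every [0 <= k], and
   this [k] makes the last term integrate to at most [delta]. *)
pose k := 2 * lam / eps.
have k0 : 0 < k by rewrite /k divr_gt0// mulr_gt0.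
have mZ (b : R) : measurable_fun setT (fun w => (expR (b * privacy_loss w))%:E).
  apply/measurable_EFinP; apply: measurableT_comp => //.
  by apply: measurable_funM => //; exact: measurable_privacy_loss.
have mZ1 : measurable_fun setT (fun w => (expR (privacy_loss w))%:E).
  by apply/measurable_EFinP; apply: measurableT_comp => //; exact: measurable_privacy_loss.
apply: (@le_trans _ _ (\int[P]_(w in S) ((expR eps)%:E +
    (expR (- (k * eps)))%:E * (expR ((1 + k) * privacy_loss w))%:E)))%E.
  apply: ge0_le_integral => //.
  - exact: measurable_funTS.
  - apply: measurable_funTS; apply: emeasurable_funD => //.
    by apply: measurable_funeM.
  move=> w _; rewrite -EFinM -EFinD lee_fin -expRD.
  have [h|h] := leP (privacy_loss w) eps.
    by rewrite ler_wpDr ?expR_ge0// ler_expR.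
  rewrite ler_wpDl ?expR_ge0// ler_expR; move: (privacy_loss w) h => l h; nra.
rewrite ge0_integralD//; try by [
  move=> w _; rewrite -EFinM lee_fin mulr_ge0 ?expR_ge0 |
  apply: measurable_funTS; exact: measurable_funeM].
rewrite integral_cst//; apply: leeD => //.
apply: (@le_trans _ _ (\int[P]_w ((expR (- (k * eps)))%:E *
    (expR ((1 + k) * privacy_loss w))%:E)))%E.
  apply: ge0_subset_integral => //.
  exact: measurable_funeM.
rewrite ge0_integralZl//.
rewrite privacy_loss_moment -EFinM lee_fin -expRD.
set V := \sum_c _ in hV *.
(* exp(-lam) is delta / 2, half of what is allowed. *)
apply: (@le_trans _ _ (expR (- lam))); last first.
  rewrite expRN lnK ?posrE ?divr_gt0// invf_div; move: d0; lra.
rewrite ler_expR.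
(* Isolating 4 lam V <= eps^2 leaves an exponent of at most -2 lam + (eps + 2 lam) / 4, which is at
   most -lam precisely when eps <= 2 lam. *)
have -> : - (k * eps) + ((1 + k) ^+ 2 - (1 + k)) * V / 2 =
    - (2 * lam) + (eps + 2 * lam) * (4 * lam * V) / (4 * eps ^+ 2).
  by rewrite /k; field; rewrite gt_eqF.
have : (eps + 2 * lam) * (4 * lam * V) / (4 * eps ^+ 2) <= (eps + 2 * lam) / 4.
  rewrite ler_pdivrMr ?mulr_gt0// ?exprn_gt0//.
  have -> : (eps + 2 * lam) / 4 * (4 * eps ^+ 2) = (eps + 2 * lam) * eps ^+ 2 by field.
  by rewrite ler_wpM2l// addr_ge0 ?ltW// mulr_gt0.
lra.
Qed.

End gaussian_shift.

(** * Sensitivity of the transcript and its differential privacy *)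

Section privacy.
Context (R : realType) (A : nat) (B : cdv_basis R A).
Local Notation I01 := (@unit_itv R).
Hypothesis wave_le : forall l k x, (k < nwave B l)%N -> I01 x ->
  `|wave B l k x| <= 2 `^ (l%:R / 2) * mother_sup B.

(** At most [cA B] wavelets of a level are nonzero at [x], each with square at most 2^l times the
    squared [mother_sup]. Summing 2^l up to L costs the factor 2. *)
Lemma sum_cwave_sqr L x : I01 x ->
  \sum_(c : coefs B L) cwave c x ^+ 2 <= 2 * 2 ^+ L * (cA B * mother_sup B ^+ 2).
Proof.
move=> Ix; set M := cA B * _.
have M0 : 0 <= M by rewrite mulr_ge0 ?sqr_ge0// ltW// cA_gt0.
have lev l : \sum_(k < nwave B l) wave B l k x ^+ 2 <= 2 ^+ l * M.
  pose p := [pred k : 'I_(nwave B l) | `[< wsupp B l k x >]].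
  rewrite (bigID p)/= [X in _ + X]big1 ?addr0; last first.
    move=> k; have [->|w0] := eqVneq (wave B l k x) 0; first by rewrite expr0n.
    by rewrite asboolT//; exact: (wsuppP Ix w0).
  apply: (@le_trans _ _ (\sum_(k < nwave B l | p k) (2 ^+ l * mother_sup B ^+ 2))).
    apply: ler_sum => k _.
    have -> : 2 ^+ l * mother_sup B ^+ 2 = (2 `^ (l%:R / 2) * mother_sup B) ^+ 2.
      rewrite exprMn; congr (_ * _).
      by rewrite -[RHS]powR_mulrn ?powR_ge0// -powRrM divfK// powR_mulrn.
    rewrite -real_normK ?num_real// lerXn2r ?nnegrE ?wave_le//.
    by rewrite mulr_ge0 ?powR_ge0// ltW// mother_sup_gt0.
  rewrite sumr_const -[_ *+ #|_|]mulr_natl [leLHS]mulrCA ler_wpM2l ?exprn_ge0//.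
  by rewrite /M ler_wpM2r ?sqr_ge0//; exact: overlap.
rewrite (@sum_coefs _ _ B _ L (fun l k => wave B l k x ^+ 2)).
apply: (le_trans (ler_sum _ (fun (l : 'I_L.+1) _ => lev l))).
rewrite -mulr_suml ler_wpM2r// -exprS.
under eq_bigr do rewrite -natrX.
by rewrite -natr_sum -natrX ler_nat ltnW// sum_pow2.
Qed.

Lemma clip_le (tau y : R) : 0 <= tau -> `|clip tau y| <= tau.
Proof.
move=> t0; rewrite /clip ler_norml le_max lexx/= ge_max ge_min lexx orbT andbT.
by rewrite lerNl (le_trans _ t0)// oppr_le0.
Qed.

(** Only one observation changes. The 8 inside the square of [c_psi] is 2 for the square of a
    difference, 2 for the old and the new observation, and 2 for the sum over levels. *)
Lemma local_coef_sensitivity L tau n (z z' : 'I_n -> R * R) :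
  0 <= tau -> (0 < n)%N -> admissible_data z -> admissible_data z' ->
  neighbours z z' ->
  \sum_(c : coefs B L) (local_coef tau z c - local_coef tau z' c) ^+ 2 <=
  tau ^+ 2 * 2 ^+ L * c_psi B ^+ 2 / n%:R ^+ 2.
Proof.
move=> t0 n0 az az' zz'.
have cpsi2 : c_psi B ^+ 2 = 8 * (cA B * mother_sup B ^+ 2).
  rewrite /c_psi !exprMn !sqr_sqrtr ?(ltW (cA_gt0 B))//; ring.
have rhs0 : 0 <= tau ^+ 2 * 2 ^+ L * c_psi B ^+ 2 / n%:R ^+ 2.
  apply: divr_ge0; last exact: sqr_ge0.
  apply: mulr_ge0; last exact: sqr_ge0.
  by apply: mulr_ge0; [exact: sqr_ge0|exact: exprn_ge0].
have [[i0 zi0]|same] := pselect (exists i, z i <> z' i); last first.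
  rewrite big1// => c _; rewrite (_ : z = z') ?subrr ?expr0n//.
  by apply/funext => i; apply: contrapT => zi; apply: same; exists i.
have others i : i != i0 -> z i = z' i.
  move=> ii; apply: contrapT => zi; move/eqP: ii; apply.
  exact: zz' zi zi0.
pose y := clip tau (z i0).1; pose y' := clip tau (z' i0).1.
pose x := (z i0).2; pose x' := (z' i0).2.
have dE (c : coefs B L) : local_coef tau z c - local_coef tau z' c =
    n%:R^-1 * (y * cwave c x - y' * cwave c x').
  rewrite /local_coef -mulrBr (bigD1 i0)//= [X in _ - X](bigD1 i0)//=.
  rewrite (eq_bigr (fun i => clip tau (z' i).1 * cwave c (z' i).2)); last first.
    by move=> i /others ->.
  by congr (_ * _); rewrite opprD addrACA subrr addr0.
have sq (c : coefs B L) : (local_coef tau z c - local_coef tau z' c) ^+ 2 <=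
    2 * tau ^+ 2 / n%:R ^+ 2 * (cwave c x ^+ 2 + cwave c x' ^+ 2).
  rewrite dE exprMn exprVn.
  rewrite [leRHS](_ : _ = (n%:R ^+ 2)^-1 *
    (2 * tau ^+ 2 * (cwave c x ^+ 2 + cwave c x' ^+ 2))); last by ring.
  rewrite ler_wpM2l ?invr_ge0 ?sqr_ge0//.
  have hy : y ^+ 2 <= tau ^+ 2.
    by rewrite -real_normK ?num_real// lerXn2r ?nnegrE// clip_le.
  have hy' : y' ^+ 2 <= tau ^+ 2.
    by rewrite -real_normK ?num_real// lerXn2r ?nnegrE// clip_le.
  apply: (@le_trans _ _ (2 * (y ^+ 2 * cwave c x ^+ 2 + y' ^+ 2 * cwave c x' ^+ 2))).
    have := sqr_ge0 (y * cwave c x + y' * cwave c x').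
    rewrite -!exprMn; nra.
  rewrite -mulrA ler_pM2l// mulrDr lerD// ler_wpM2r ?sqr_ge0//.
apply: (le_trans (ler_sum _ (fun c _ => sq c))).
rewrite -mulr_sumr big_split/=.
have Sx := sum_cwave_sqr L (az i0); have Sx' := sum_cwave_sqr L (az' i0).
rewrite cpsi2; set M := cA B * _ in Sx Sx' *.
apply: (@le_trans _ _ (2 * tau ^+ 2 / n%:R ^+ 2 * (4 * 2 ^+ L * M))).
  rewrite ler_wpM2l ?divr_ge0 ?mulr_ge0 ?sqr_ge0//.
  move: Sx Sx'; rewrite -/x -/x'; lra.
by rewrite le_eqVlt; apply/orP; left; apply/eqP; ring.
Qed.

(** The noise variance is the sensitivity bound times 4 ln(2/delta) / eps^2, which is the
    calibration that [gaussian_mechanism] asks for. The centre is the coefficient vector of [z'],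
    the shift leads to that of [z]. *)
Lemma transcript_diff_private d (T : measurableType d) (P : probability T R)
    L tau n eps delta (W : coefs B L -> {RV P >-> R}) :
  0 < tau -> (0 < n)%N -> 0 < eps -> 0 < delta <= 1 ->
  eps <= 2 * ln (2 / delta) ->
  (forall c, has_law (W c)
    (normal_prob 0 (Num.sqrt (noise_var B L tau n eps delta)))) ->
  mutually_independent P (fun c => W c) ->
  diff_private eps delta (transcript_law (k := n) tau W).
Proof.
move=> t0 n0 e0 d01 el lW iW z z' az az' zz' E mE.
have V0 := noise_var_gt0 B L t0 n0 e0 d01.
have s0 : Num.sqrt (noise_var B L tau n eps delta) != 0.
  by rewrite gt_eqF// sqrtr_gt0.
have := gaussian_mechanism
  (v := fun c => local_coef tau z c - local_coef tau z' c) s0 lW iW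
  (local_coef tau z') e0 d01 el _ mE.
rewrite /transcript_law /transcript.
have -> : [set w | E (fun c : coefs B L => local_coef tau z' c +
      (local_coef tau z c - local_coef tau z' c) + W c w)] =
    [set w | E (fun c => local_coef tau z c + W c w)].
  apply/seteqP; split => w /=; congr (E _); apply/funext => c; by rewrite subrKC.
apply; rewrite -mulr_suml sqr_sqrtr ?(ltW V0)//.
have sens := local_coef_sensitivity L (ltW t0) n0 az az' zz'.
set S := \sum_c _ in sens *.
rewrite mulrA ler_pdivrMr//.
rewrite [leRHS](_ : _ = 4 * ln (2 / delta) *
    (tau ^+ 2 * 2 ^+ L * c_psi B ^+ 2 / n%:R ^+ 2)); last first.
  by rewrite /noise_var; field; rewrite pnatr_eq0 -lt0n n0 gt_eqF.
rewrite ler_wpM2l// mulr_ge0// ltW//; case/andP: d01 => d0 d1.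
by rewrite ln_gt0// ltr_pdivlMr// mul1r (le_lt_trans d1)// ltr1n.
Qed.

End privacy.

(** * The risk of the estimator *)

Section uniform_design.
Context d (T : measurableType d) (R : realType) (P : probability T R).
Variable X : {RV P >-> R}.
Local Notation I01 := (@unit_itv R).
Local Notation lebesgue := (@lebesgue_measure R).
Hypothesis rX : forall w, I01 (X w).
Hypothesis lX : has_law X (uniform_prob (@ltr01 R)).

Lemma uniform_indic (U : set R) : measurable U ->
  (\int[lebesgue]_(x in id @^-1` U) (\1_I01 x : R)%:E = uniform_prob (@ltr01 R) U)%E.
Proof.
move=> mU; rewrite /uniform_prob; apply: eq_integral => x _; congr EFin.
rewrite /uniform_pdf indicE subr0 invr1.
have -> : (x \in I01) = (0 <= x <= 1); last by case: ifP.
apply/idP/idP => [/set_mem|h]; first by rewrite /unit_itv /= in_itv.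
by apply/mem_set; rewrite /unit_itv /= in_itv.
Qed.

Lemma uniform_expectation (g : R -> R) : measurable_fun I01 g ->
  lebesgue.-integrable I01 (EFin \o g) ->
  P.-integrable setT (EFin \o (g \o X)) /\
  \int[P]_w g (X w) = \int[lebesgue]_(x in I01) g x.
Proof.
move=> mg ig; have mI := @measurable_unit_itv R.
(* [g] is controlled only on [0,1]; its extension by zero is measurable on the line and agrees with
   [g] along [X]. *)
pose h := g \_ I01.
have mh : measurable_fun setT h by apply/(measurable_restrictT g mI).
have ih : lebesgue.-integrable setT (EFin \o h).
  by move: ig; rewrite (integrable_mkcond _ mI) restrict_EFin.
have m1 : measurable_fun setT (\1_I01 : R -> R) by exact: measurable_indic.
have ih' : (uniform_prob (@ltr01 R)).-integrable setT (EFin \o h).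
  apply/integrableP; split; first exact/measurable_EFinP.
  have mah : measurable_fun setT (fun x => `|h x|%:E).
    by apply/measurable_EFinP; exact: measurableT_comp.
  rewrite -(@ge0_integral_weighted _ _ _ _ R lebesgue (uniform_prob (@ltr01 R))
    \1_I01 id m1 (fun=> _) (@measurable_id _ _ setT) uniform_indic
    (fun x => `|h x|%:E) mah (fun=> _))//.
  have /integrableP[_] := ih; apply: le_lt_trans.
  apply: ge0_le_integral => //.
  - by apply: emeasurable_funM => //; exact/measurable_EFinP.
  - move=> x _; rewrite /= -EFinM lee_fin indicE.
    by case: (x \in _); rewrite ?mul1r// mul0r.
have hX : h \o X = g \o X.
  by apply/funext => w; rewrite /h /= patchE mem_set.
split; first by rewrite -hX; exact: (integrable_law lX mh ih').
transitivity (\int[P]_w h (X w)).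
  by apply: eq_Rintegral => w _; have := congr1 (@^~ w) hX => /= ->.
rewrite (Rintegral_law lX mh ih') [RHS]Rintegral_mkcond.
rewrite -(@Rintegral_weighted _ _ _ _ R lebesgue (uniform_prob (@ltr01 R))
    \1_I01 id m1 (fun=> _) (@measurable_id _ _ setT) uniform_indic h mh ih')//.
apply: eq_Rintegral => x _; rewrite indicE /h patchE.
by case: ifP; rewrite ?mul1r ?mul0r.
Qed.

(** The law of [X] has a Lebesgue density, so null sets pull back to null events. This carries the
    almost everywhere bound on [f] to the design points. *)
Lemma uniform_ae (Q : R -> Prop) :
  {ae lebesgue, forall x, I01 x -> Q x} -> {ae P, forall w, Q (X w)}.
Proof.
move=> [N [mN N0 NQ]]; exists (X @^-1` N); split.
- exact: measurable_preimage.
- have := lX mN; rewrite /distribution /pushforward => ->.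
  apply: null_set_integral => //.
  apply/measurable_funTS/measurable_EFinP; exact: measurable_uniform_pdf.
- by move=> w nQ; apply: NQ => /= h; apply: nQ; exact: h.
Qed.

End uniform_design.

Section uncorrelated.
Context d (T : measurableType d) (R : realType) (P : probability T R).

Lemma Rintegral_probability_cst (c : R) : \int[P]_w c = c.
Proof.
transitivity (c * fine (P setT)); first exact: Rintegral_cst.
by rewrite probability_setT mulr1.
Qed.

Lemma integral_probability_cst (c : R) : (\int[P]_w c%:E = c%:E)%E.
Proof.
transitivity (c%:E * P setT)%E; first exact: integral_cst.
by rewrite probability_setT mule1.
Qed.

(** The cross terms of the centred variables vanish, and each variance is at most the second
    moment. *)
Lemma uncorrelated_second_moment (O : finType) (G : O -> T -> R) (a : O -> R) (v : R) :
  (forall o, P.-integrable setT (EFin \o G o)) ->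
  (forall o o', P.-integrable setT (EFin \o (fun w => G o w * G o' w))) ->
  (forall o o', o != o' -> \int[P]_w (G o w * G o' w) =
     (\int[P]_w G o w) * (\int[P]_w G o' w)) ->
  (forall o, \int[P]_w (G o w * G o w) <= v) ->
  P.-integrable setT (EFin \o (fun w => (\sum_o a o * (G o w - \int[P]_x G o x)) ^+ 2)) /\
  \int[P]_w (\sum_o a o * (G o w - \int[P]_x G o x)) ^+ 2 <= v * \sum_o a o ^+ 2.
Proof.
move=> iG iGG uG vG.
pose e o := \int[P]_x G o x.
pose K o o' w := (a o * a o') * ((G o w - e o) * (G o' w - e o')).
have KE w : (\sum_o a o * (G o w - e o)) ^+ 2 = \sum_o \sum_o' K o o' w.
  rewrite expr2 mulr_suml; apply: eq_bigr => o _.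
  by rewrite mulr_sumr; apply: eq_bigr => o' _; rewrite /K; ring.
have icst (c : R) : P.-integrable setT (EFin \o (fun=> c)).
  exact: finite_measure_integrable_cst.
have KE2 o o' w : (G o w - e o) * (G o' w - e o') =
    (G o w * G o' w + - e o' * G o w) + (- e o * G o' w + e o * e o') by ring.
have i1 o o' := integrableD_EFin measurableT (iGG o o')
  (integrableZr_EFin measurableT (- e o') (iG o)).
have i2 o o' := integrableD_EFin measurableT
  (integrableZr_EFin measurableT (- e o) (iG o')) (icst (e o * e o')).
have ic o o' : P.-integrable setT (EFin \o (fun w => (G o w - e o) * (G o' w - e o'))).
  have := integrableD_EFin measurableT (i1 o o') (i2 o o').
  by apply: eq_integrable => // w _; rewrite /= KE2.
have iK o o' : P.-integrable setT (EFin \o K o o').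
  by apply: integrableZr_EFin.
have covE o o' : \int[P]_w ((G o w - e o) * (G o' w - e o')) =
    \int[P]_w (G o w * G o' w) - e o * e o'.
  under eq_Rintegral do rewrite KE2.
  rewrite RintegralD//.
  rewrite RintegralD//; last by apply: integrableZr_EFin.
  rewrite RintegralD//; last by apply: integrableZr_EFin.
  rewrite !RintegralZl// Rintegral_probability_cst -/(e o) -/(e o'); ring.
have EK : \int[P]_w (\sum_o \sum_o' K o o' w) =
    \sum_o a o ^+ 2 * (\int[P]_w (G o w * G o w) - e o * e o).
  rewrite Rintegral_sumr//; last by move=> o; exact: integrable_sumr.
  apply: eq_bigr => o _; rewrite Rintegral_sumr// (bigD1 o)//= big1 ?addr0.
    by rewrite /K RintegralZl// covE expr2.
  move=> o' oo'; rewrite /K RintegralZl// covE uG 1?eq_sym//.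
  by rewrite subrr mulr0.
rewrite -/e; split.
  have := integrable_sumr measurableT (fun o => integrable_sumr measurableT (iK o)).
  by apply: eq_integrable => // w _; rewrite /= KE.
under eq_Rintegral do rewrite KE.
rewrite EK mulr_sumr; apply: ler_sum => o _.
rewrite mulrC ler_wpM2r ?sqr_ge0//.
by rewrite (le_trans _ (vG o))// lerBlDr lerDl -expr2 sqr_ge0.
Qed.

End uncorrelated.

(** * Independence statements extracted from the joint family of sources *)

Section sources.
Context (R : realType) (A : nat) (B : cdv_basis R A).
Context d (T : measurableType d) (P : probability T R).
Context (m : nat) (n : 'I_m -> nat) (L : nat).
Variables (X xi : obs n -> {RV P >-> R}) (W : 'I_m -> coefs B L -> {RV P >-> R}).
Hypothesis ind : mutually_independent P (all_sources X xi W).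

Lemma independent_noise_coef (c : coefs B L) :
  mutually_independent P (fun j => W j c).
Proof.
have := @mutually_independent_sub _ _ _ P _ _
  (fun j : 'I_m => inr (j, c) : obs n + obs n + 'I_m * coefs B L) _ _ ind.
by apply => j j' [].
Qed.

Lemma independent_noise_server (j : 'I_m) :
  mutually_independent P (fun c => W j c).
Proof.
have := @mutually_independent_sub _ _ _ P _ _
  (fun c : coefs B L => inr (j, c) : obs n + obs n + 'I_m * coefs B L) _ _ ind.
apply => c c' /(congr1 (fun x => if x is inr (_, y) then y else c)).
by [].
Qed.

Lemma indep_error_design (o : obs n) : indep_vars P (xi o) (X o).
Proof.
move=> U V mU mV.
pose sel (b : bool) : obs n + obs n + 'I_m * coefs B L :=
  inl (if b then inr o else inl o).
have selI : injective sel by move=> [] [].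
have := @mutually_independent_prob _ _ _ P _ _ (fun b : bool => if b then U else V)
  (mutually_independent_sub selI ind).
rewrite big_bool /= => <-; last by case.
congr (P _); apply/seteqP; split => w /=; first by move=> [Uw Vw]; case.
by move=> h; split; [exact: (h true)|exact: (h false)].
Qed.

(** Mutual independence of the four real variables gives the product rule on rectangles. Two Dynkin
    extensions, one per observation, reach all measurable sets of the plane. *)
Lemma indep_observations (o o' : obs n) : o != o' ->
  indep_vars P (fun w => (X o w, xi o w)) (fun w => (X o' w, xi o' w)).
Proof.
move=> oo'.
have mV q : measurable_fun setT (fun w => (X q w, xi q w)).
  exact: measurable_fun_pair.
pose rect := [set (U1 `*` U2 : set (R * R)) | U1 in measurable & U2 in measurable].
have rectE : @measurable _ (R * R)%type = <<s rect >>.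
  exact: measurable_prod_measurableType.
have rectI : setI_closed rect.
  move=> _ _ [U1 mU1 [U2 mU2 <-]] [V1 mV1 [V2 mV2 <-]].
  exists (U1 `&` V1); first exact: measurableI.
  by exists (U2 `&` V2); [exact: measurableI|rewrite setXI].
have four U1 U2 V1 V2 : measurable U1 -> measurable U2 -> measurable V1 ->
    measurable V2 ->
    P [set w | [/\ U1 (X o w), U2 (xi o w), V1 (X o' w) & V2 (xi o' w)]] =
    (P (X o @^-1` U1) * P (xi o @^-1` U2) *
     (P (X o' @^-1` V1) * P (xi o' @^-1` V2)))%E.
  move=> m1 m2 m3 m4.
  pose sel (b : bool * bool) : obs n + obs n + 'I_m * coefs B L :=
    let q := if b.1 then o else o' in inl (if b.2 then inl q else inr q).
  have selI : injective sel.
    move=> [[] []] [[] []] //= [] oE; by move: oo'; rewrite oE eqxx.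
  have := @mutually_independent_prob _ _ _ P _ _
    (fun b : bool * bool => if b.1 then (if b.2 then U1 else U2)
       else (if b.2 then V1 else V2)) (mutually_independent_sub selI ind).
  rewrite -(pair_big xpredT xpredT (fun b1 b2 => P ((all_sources X xi W \o sel) (b1, b2)
    @^-1` (if b1 then (if b2 then U1 else U2) else (if b2 then V1 else V2)))))/=.
  rewrite !big_bool /= => <-; last by move=> [[] []].
  congr (P _); apply/seteqP; split => w /=.
    by move=> [h1 h2 h3 h4] [[] []].
  by move=> h; split; [exact: (h (true, true))|exact: (h (true, false))
    |exact: (h (false, true))|exact: (h (false, false))].
have two q U1 U2 : measurable U1 -> measurable U2 ->
    P ((fun w => (X q w, xi q w)) @^-1` (U1 `*` U2)) =
    (P (X q @^-1` U1) * P (xi q @^-1` U2))%E.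
  move=> m1 m2; rewrite muleC -indep_error_design//; congr (P _).
  by rewrite setIC.
move=> Aq Bq mA mB; rewrite setIC muleC.
apply: (indep_event_generated rectE rectI (mV o') _ _ mB).
  exact: (measurable_preimage (mV o) mA).
move=> _ [V1 mV1 [V2 mV2 <-]]; rewrite setIC muleC.
apply: (indep_event_generated rectE rectI (mV o) _ _ mA).
  by apply: (measurable_preimage (mV o')); exact: measurableX.
move=> _ [U1 mU1 [U2 mU2 <-]]; rewrite !two// -four//.
congr (P _); apply/seteqP; split => w /=; first by move=> [[? ?] [? ?]].
by move=> [? ? ? ?].
Qed.

End sources.

Section clipping.
Context (R : realType).

(** As |a| <= K, the sum [a + e] can leave the interval [-(K + s), K + s] by at most |e| - s. *)
Lemma clip_residual (K s a e : R) : 0 <= K -> 0 <= s -> `|a| <= K ->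
  `|clip (K + s) (a + e) - (a + e)| <= excess s e.
Proof.
move=> K0 s0; rewrite ler_norml => /andP[a1 a2].
have e1 := ler_norm e; have e2 := ler_norm (- e); rewrite normrN in e2.
rewrite /clip /excess le_max; case: (lerP (a + e) (K + s)) => h1.
  case: (lerP (- (K + s)) (a + e)) => h2; first by rewrite subrr normr0 lexx orbT.
  by apply/orP; left; rewrite ger0_norm; lra.
case: (lerP (- (K + s)) (K + s)) => h2; last lra.
by apply/orP; left; rewrite ler0_norm; lra.
Qed.

Lemma measurable_clip d (T : measurableType d) (tau : R) (g : T -> R) :
  measurable_fun setT g -> measurable_fun setT (fun x => clip tau (g x)).
Proof. by move=> mg; apply: measurable_maxr => //; exact: measurable_minr. Qed.

End clipping.

Section probability_integrals.
Context d (T : measurableType d) (R : realType) (P : probability T R).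

Lemma integrable_bounded (g : T -> R) (K : R) : measurable_fun setT g ->
  (forall w, `|g w| <= K) -> P.-integrable setT (EFin \o g).
Proof.
move=> mg gK; apply: measurable_bounded_integrable => //.
  by rewrite (le_lt_trans (probability_le1 _ _))// ltry.
exists K; split; first exact: num_real.
by move=> K' KK' w _; exact: (le_trans (gK w) (ltW KK')).
Qed.

End probability_integrals.

Section coefficient_risk.
Context (R : realType) (A : nat) (B : cdv_basis R A).
Context d (T : measurableType d) (P : probability T R).
Context (m : nat) (n : 'I_m -> nat) (L : nat).
Variables (X xi : obs n -> {RV P >-> R}) (W : 'I_m -> coefs B L -> {RV P >-> R}).
Variables (f : R -> R) (K s : R) (eps delta : 'I_m -> R).
Local Notation I01 := (@unit_itv R).
Local Notation lebesgue := (@lebesgue_measure R).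
Local Notation tau := (K + s).
Hypothesis K0 : 0 < K.
Hypothesis s0 : 0 < s.
Hypothesis f2 : L2_01 f.
Hypothesis fK : {ae lebesgue, forall x : R, I01 x -> `|f x| <= K}.
Hypothesis mod : sampling_model tau eps delta X xi W.

Let tau0 : 0 < tau. Proof. exact: addr_gt0. Qed.
Let rX o w : I01 (X o w). Proof. exact: (design_range mod). Qed.
Let lX o : has_law (X o) (uniform_prob (@ltr01 R)). Proof. exact: (design_law mod). Qed.
Let lxi o : has_law (xi o) (normal_prob 0 1). Proof. exact: (error_law mod). Qed.
Let ind := sources_independent mod.
Let mI : measurable (I01 : set (measurableTypeR R)) := @measurable_unit_itv R.

Definition score (c : coefs B L) (o : obs n) (w : T) : R :=
  clip tau (f (X o w) + xi o w) * cwave c (X o w).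

(** Extending [f] and the wavelet by zero turns the score into a globally measurable function of the
    pair of design point and error, the form required by [indep_varsM]. *)
Definition score_kernel (c : coefs B L) (z : R * R) : R :=
  clip tau ((f \_ I01) z.1 + z.2) * (cwave c \_ I01) z.1.

Lemma scoreE c o w : score c o w = score_kernel c (X o w, xi o w).
Proof. by rewrite /score /score_kernel /= !patchE mem_set. Qed.

Lemma measurable_score_kernel c : measurable_fun setT (score_kernel c).
Proof.
have [mf _] := f2.
have mf1 : measurable_fun setT (f \_ I01) by apply/(measurable_restrictT f mI).
have mc1 : measurable_fun setT (cwave c \_ I01).
  by apply/(measurable_restrictT _ mI); exact: measurable_cwave.
apply: measurable_funM.
  apply: measurable_clip; apply: measurable_funD => //.
  exact: (measurableT_comp mf1 measurable_fst).
exact: (measurableT_comp mc1 measurable_fst).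
Qed.

Lemma measurable_score c o : measurable_fun setT (score c o).
Proof.
have mp : measurable_fun setT (fun w => (X o w, xi o w)).
  exact: measurable_fun_pair.
have -> : score c o = score_kernel c \o (fun w => (X o w, xi o w)).
  by apply/funext => w; exact: scoreE.
exact: measurableT_comp (measurable_score_kernel c) mp.
Qed.

Lemma bounded_score c : exists K', forall o w, `|score c o w| <= K'.
Proof.
have [M HM] := bounded_cwave c; exists (tau * M) => o w.
by rewrite /score normrM ler_pM// ?HM// clip_le// ltW.
Qed.

Lemma integrable_score c o : P.-integrable setT (EFin \o score c o).
Proof.
have [K' HK'] := bounded_score c.
exact: (integrable_bounded P (measurable_score c o) (HK' o)).
Qed.

Lemma integrable_scoreM c o o' :
  P.-integrable setT (EFin \o (fun w => score c o w * score c o' w)).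
Proof.
have [K' HK'] := bounded_score c.
apply: (@integrable_bounded _ _ _ P _ (K' * K')) => [|w].
  by apply: measurable_funM; exact: measurable_score.
by rewrite normrM ler_pM.
Qed.

Lemma score_uncorrelated c o o' : o != o' ->
  \int[P]_w (score c o w * score c o' w) =
  (\int[P]_w score c o w) * (\int[P]_w score c o' w).
Proof.
move=> oo'.
have mp q : measurable_fun setT (fun w => (X q w, xi q w)).
  exact: measurable_fun_pair.
have iq q : P.-integrable setT
    (EFin \o (score_kernel c \o (fun w => (X q w, xi q w)))).
  by have := integrable_score c q; apply: eq_integrable => // w _;
    rewrite /= -scoreE.
have [_ E] := indep_varsM (mp o) (mp o') (indep_observations ind oo')
  (measurable_score_kernel c) (measurable_score_kernel c) (iq o) (iq o').
under eq_Rintegral do rewrite !scoreE.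
rewrite E; congr (_ * _); apply: eq_Rintegral => w _; by rewrite scoreE.
Qed.

Let iphi2 (c : coefs B L) :
  lebesgue.-integrable I01 (EFin \o (fun x => cwave c x ^+ 2)).
Proof.
apply: integrable_bounded_on01; first by apply: measurable_funX; exact: measurable_cwave.
by apply: bounded_on01M; exact: bounded_cwave.
Qed.

Let phi2 (c : coefs B L) : \int[lebesgue]_(x in I01) (cwave c x ^+ 2) = 1.
Proof.
by have := inner01_cwave c c; rewrite eqxx /inner01.
Qed.

(** The clipped response is at most tau in absolute value, and the squared wavelet has mean 1 under
    the uniform design. *)
Lemma score_second_moment c o :
  \int[P]_w (score c o w * score c o w) <= tau ^+ 2.
Proof.
have [i2 e2] := uniform_expectation (@rX o) (@lX o)
  (measurable_funX 2 (@measurable_cwave _ _ B L c)) (iphi2 c).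
apply: (@le_trans _ _ (\int[P]_w (tau ^+ 2 * cwave c (X o w) ^+ 2))).
  apply: le_Rintegral => //; first exact: integrable_scoreM.
    exact: integrableZr_EFin.
  move=> w _; rewrite /score -expr2 exprMn ler_wpM2r ?sqr_ge0//.
  by rewrite -real_normK ?num_real// lerXn2r ?nnegrE ?clip_le// ltW.
by rewrite RintegralZl// e2 phi2 mulr1.
Qed.

(** Without clipping the mean is exactly the coefficient, because the error is centred and
    independent of the design. The clipping residual contributes at most E excess times E|phi(X)|,
    again by independence, and E|phi(X)| <= 1. *)
Lemma score_bias c o :
  `|\int[P]_w score c o w - inner01 f (cwave c)| <=
  2 / s * expR (- (s ^+ 2 / 2)).
Proof.
set phi := cwave c.
have mphi := @measurable_cwave _ _ B L c; have bphi := @bounded_cwave _ _ B L c.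
have iphi := integrable_bounded_on01 mphi bphi.
have [mf _] := f2.
have ifphi := L2_01_integrableM f2 mphi bphi.
have mfphi : measurable_fun I01 (fun x => f x * phi x) by exact: measurable_funM.
have [iE1 E1] := uniform_expectation (@rX o) (@lX o) mfphi ifphi.
have mphi1 : measurable_fun setT (phi \_ I01) by apply/(measurable_restrictT _ mI).
have phiX w : (phi \_ I01) (X o w) = phi (X o w) by rewrite patchE mem_set.
have iphiX : P.-integrable setT (EFin \o ((phi \_ I01) \o X o)).
  have [h _] := uniform_expectation (@rX o) (@lX o) mphi iphi.
  by move: h; apply: eq_integrable => // w _; rewrite /= phiX.
have n1 : (1 : R) != 0 by exact: oner_neq0.
have ixi : P.-integrable setT (EFin \o (id \o xi o)).
  exact: (integrable_law (@lxi o) (@measurable_id _ _ setT) (integrable_normal_id n1)).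
have xi_mean : \int[P]_w (id (xi o w)) = 0.
  rewrite (Rintegral_law (@lxi o) (@measurable_id _ _ setT) (integrable_normal_id n1)).
  exact: Rintegral_normal_id.
have mxi : measurable_fun setT (xi o) by [].
have mX : measurable_fun setT (X o) by [].
have [iE2 E2] := indep_varsM mxi mX (indep_error_design ind o)
  (@measurable_id _ _ setT) mphi1 ixi iphiX.
pose H w := (clip tau (f (X o w) + xi o w) - (f (X o w) + xi o w)) * phi (X o w).
have HE w : score c o w = H w + (f (X o w) * phi (X o w) + xi o w * (phi \_ I01) (X o w)).
  by rewrite phiX /score /H /phi; ring.
have iB : P.-integrable setT (EFin \o
    (fun w => f (X o w) * phi (X o w) + xi o w * (phi \_ I01) (X o w))).
  apply: integrableD_EFin => //.
have iH : P.-integrable setT (EFin \o H).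
  have := integrableB_EFin measurableT (integrable_score c o) iB.
  by apply: eq_integrable => // w _; rewrite /= HE addrK.
have -> : \int[P]_w score c o w - inner01 f phi = \int[P]_w H w.
  under eq_Rintegral do rewrite HE.
  rewrite RintegralD// RintegralD//.
  rewrite E1 E2 xi_mean.
  by rewrite mul0r addr0 /inner01 addrK.
have absX : P.-integrable setT (EFin \o ((fun x => `|x|) \o ((phi \_ I01) \o X o))).
  have := integrable_norm iphiX.
  by apply: eq_integrable.
have mexc := @measurable_excess R s.
have excess_fin : (\int[P]_w (excess s (xi o w))%:E <= (2 / s * expR (- (s ^+ 2 / 2)))%:E)%E.
  rewrite (ge0_integral_law (@lxi o) mexc (excess_ge0 s)).
  exact: normal_excess.
(* Uses |t| <= (1 + t^2) / 2 and the unit norm of the wavelet. *)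
have abs_fin : (\int[P]_w (`|(phi \_ I01) (X o w)|)%:E <= 1%:E)%E.
  have [i2 e2] := uniform_expectation (@rX o) (@lX o)
    (measurable_funX 2 mphi) (iphi2 c).
  have ib : P.-integrable setT (EFin \o (fun w => 2^-1 * (1 + phi (X o w) ^+ 2))).
    apply: integrableZr_EFin => //; apply: integrableD_EFin => //.
    exact: finite_measure_integrable_cst.
  have -> : (\int[P]_w (`|(phi \_ I01) (X o w)|)%:E)%E =
      (\int[P]_w `|(phi \_ I01) (X o w)|)%:E.
    by rewrite /Rintegral fineK//; exact: (integrable_fin_num measurableT absX).
  rewrite lee_fin.
  apply: (@le_trans _ _ (\int[P]_w (2^-1 * (1 + phi (X o w) ^+ 2)))).
    apply: le_Rintegral => // w _; rewrite phiX.
    rewrite -real_normK ?num_real//; have := sqr_ge0 (`|phi (X o w)| - 1); nra.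
  rewrite RintegralZl//; last first.
    by apply: integrableD_EFin => //; exact: finite_measure_integrable_cst.
  rewrite RintegralD//; last exact: finite_measure_integrable_cst.
  by rewrite Rintegral_probability_cst e2 phi2; lra.
have h0 : 0 <= 2 / s * expR (- (s ^+ 2 / 2)).
  by rewrite mulr_ge0 ?expR_ge0// divr_ge0// ltW.
apply: le_trans (le_normr_Rintegral measurableT iH) _.
have iaH := integrable_norm iH.
rewrite -lee_fin fineK; last exact: (integrable_fin_num measurableT iaH).
have mphia : measurable_fun setT (fun x => `|(phi \_ I01) x|) by exact: measurableT_comp.
apply: (@le_trans _ _ (\int[P]_w (excess s (xi o w) * `|(phi \_ I01) (X o w)|)%:E))%E.
  apply: ae_ge0_le_integral => //.
  - by case/integrableP: iaH.
  - by move=> w _; rewrite lee_fin mulr_ge0// excess_ge0.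
  - apply/measurable_EFinP; apply: measurable_funM.
      exact: measurableT_comp.
    exact: (measurableT_comp mphia).
  have := uniform_ae (@rX o) (@lX o) fK.
  apply: filterS => w fw _; rewrite lee_fin /H normrM phiX ler_wpM2r//.
  by apply: clip_residual => //; exact: ltW.
have iUV := indep_error_design ind o.
rewrite (@ge0_indep_varsM _ _ _ _ _ _ R P (xi o) (X o) (excess s)
  (fun x => `|(phi \_ I01) x|))//.
- rewrite -[leRHS]mule1; apply: lee_pmul => //.
    by apply: integral_ge0 => w _; rewrite lee_fin excess_ge0.
  by apply: integral_ge0 => w _; rewrite lee_fin.
- exact: excess_ge0.
- by rewrite (le_lt_trans excess_fin)// ltry.
- by rewrite (le_lt_trans abs_fin)// ltry.
Qed.

Variable u : 'I_m -> R.
Hypothesis n_gt0 : forall j, (0 < n j)%N.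
Hypothesis u_gt0 : forall j, 0 < u j.
Hypothesis sum_u : \sum_j u j = 1.
Hypothesis sigma_gt0 : forall j, 0 < noise_var B L tau (n j) (eps j) (delta j).

Definition coef_estimate (c : coefs B L) (w : T) : R :=
  \sum_j u j * transcript tau (local_data f X xi w (j := j)) (fun c => W j c w) c.

Definition score_weight (o : obs n) : R := u (tag o) * (n (tag o))%:R^-1.

Lemma sum_obs (F : 'I_m -> R) (H : obs n -> R) :
  \sum_(o : obs n) F (tag o) * H o =
  \sum_j F j * \sum_(i < n j) H (Tagged (fun j => 'I_(n j)) i).
Proof.
under [RHS]eq_bigr do rewrite mulr_sumr.
rewrite (@sig_big_dep _ _ _ 'I_m (fun j => 'I_(n j)) xpredT (fun _ => xpredT)
  (fun j i => F j * H (Tagged (fun j => 'I_(n j)) i)))/=.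
by apply: eq_bigr => -[j i] _.
Qed.

Lemma sum_score_weight : \sum_o score_weight o = 1.
Proof.
rewrite -sum_u.
transitivity (\sum_(o : obs n) (u (tag o) * (n (tag o))%:R^-1) * 1).
  by apply: eq_bigr => o _; rewrite mulr1.
rewrite (sum_obs (fun j => u j * (n j)%:R^-1) (fun=> 1)).
apply: eq_bigr => j _; rewrite sumr_const card_ord -mulrA mulVf ?mulr1//.
by rewrite pnatr_eq0 -lt0n.
Qed.

Lemma sum_score_weight_sqr :
  \sum_o score_weight o ^+ 2 = \sum_j u j ^+ 2 / (n j)%:R.
Proof.
transitivity (\sum_(o : obs n) (u (tag o) * (n (tag o))%:R^-1) ^+ 2 * 1).
  by apply: eq_bigr => o _; rewrite mulr1.
rewrite (sum_obs (fun j => (u j * (n j)%:R^-1) ^+ 2) (fun=> 1)).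
apply: eq_bigr => j _; rewrite sumr_const card_ord exprMn -mulrA; congr (_ * _).
have n0 : (n j)%:R != 0 :> R by rewrite pnatr_eq0 -lt0n.
by field.
Qed.

Lemma coef_estimateE c w : coef_estimate c w =
  \sum_o score_weight o * score c o w + \sum_j u j * W j c w.
Proof.
rewrite (sum_obs (fun j => u j * (n j)%:R^-1) (fun o => score c o w)).
rewrite /coef_estimate -big_split/=; apply: eq_bigr => j _.
by rewrite /transcript /local_coef mulrDr mulrA.
Qed.

Lemma measurable_coef_estimate c : measurable_fun setT (coef_estimate c).
Proof.
rewrite (funext (coef_estimateE c)); apply: measurable_funD.
  by apply: measurable_sum => o; apply: measurable_funM => //; exact: measurable_score.
by apply: measurable_sum => j; exact: measurable_funM.
Qed.

(** The 3 comes from (a + b + c)^2 <= 3 (a^2 + b^2 + c^2), which disposes of the cross terms between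
    data and noise. *)
Definition coef_mse_bound : R :=
  3 * ((2 / s * expR (- (s ^+ 2 / 2))) ^+ 2
     + tau ^+ 2 * \sum_j u j ^+ 2 / (n j)%:R
     + 8 * expR 2^-1 * \sum_j u j ^+ 2 * noise_var B L tau (n j) (eps j) (delta j)).

Lemma coef_mse (c : coefs B L) : (0 < m)%N ->
  (\int[P]_w ((coef_estimate c w - inner01 f (cwave c)) ^+ 2)%:E <=
   coef_mse_bound%:E)%E.
Proof.
move=> m0; set theta := inner01 f _; set h := 2 / s * expR (- (s ^+ 2 / 2)).
pose e o := \int[P]_w score c o w.
pose S w := \sum_o score_weight o * (score c o w - e o).
pose bias := \sum_o score_weight o * (e o - theta).
pose Z w := \sum_j u j * W j c w.
have split3 w : coef_estimate c w - theta = S w + bias + Z w.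
  rewrite coef_estimateE addrAC -/(Z w); congr (_ + _).
  have thetaE : theta = \sum_o score_weight o * theta.
    by rewrite -mulr_suml sum_score_weight mul1r.
  rewrite /S /bias -big_split/= [X in _ - X = _]thetaE -sumrB.
  by apply: eq_bigr => o _; ring.
have w0 o : 0 <= score_weight o.
  by rewrite /score_weight mulr_ge0 ?invr_ge0 ?ler0n// ltW.
have hbias : bias ^+ 2 <= h ^+ 2.
  have h0 : 0 <= h by rewrite mulr_ge0 ?expR_ge0// divr_ge0// ltW.
  rewrite -real_normK ?num_real// lerXn2r ?nnegrE//.
  apply: le_trans (ler_norm_sum _ _ _) _.
  rewrite -[leRHS]mul1r -sum_score_weight mulr_suml; apply: ler_sum => o _.
  by rewrite normrM (ger0_norm (w0 o)) ler_wpM2l//; exact: score_bias.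
have [iS eS] := uncorrelated_second_moment score_weight (integrable_score c)
  (integrable_scoreM c) (score_uncorrelated c) (score_second_moment c).
rewrite sum_score_weight_sqr in eS.
have sg0 j : Num.sqrt (noise_var B L tau (n j) (eps j) (delta j)) != 0.
  by rewrite gt_eqF// sqrtr_gt0.
have sgE : \sum_j u j ^+ 2 * Num.sqrt (noise_var B L tau (n j) (eps j) (delta j)) ^+ 2 =
    \sum_j u j ^+ 2 * noise_var B L tau (n j) (eps j) (delta j).
  by apply: eq_bigr => j _; rewrite sqr_sqrtr// ltW.
(* A server exists, so the total noise variance is positive and can be normalised in
   [gaussian_family_second_moment]. *)
have q0 : 0 < \sum_j u j ^+ 2 * Num.sqrt (noise_var B L tau (n j) (eps j) (delta j)) ^+ 2.
  rewrite sgE (bigD1 (Ordinal m0))//=; apply: ltr_pwDl.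
    by apply: mulr_gt0 => //; rewrite exprn_gt0.
  by apply: sumr_ge0 => j _; apply: mulr_ge0; rewrite ?sqr_ge0// ltW.
have eZ := gaussian_family_second_moment sg0 (fun j => noise_law mod j c)
  (independent_noise_coef ind c) q0.
rewrite sgE -/(Z _) in eZ.
have mZ : measurable_fun setT Z by apply: measurable_sum => j; exact: measurable_funM.
have mS : measurable_fun setT S.
  apply: measurable_sum => o; apply: measurable_funM => //.
  by apply: measurable_funB => //; exact: measurable_score.
have eS' : (\int[P]_w (S w ^+ 2)%:E <= (tau ^+ 2 * \sum_j u j ^+ 2 / (n j)%:R)%:E)%E.
  by move: eS; rewrite -lee_fin fineK//; exact: (integrable_fin_num measurableT iS).
apply: (@le_trans _ _ (\int[P]_w (3%:E * (((S w ^+ 2)%:E + (bias ^+ 2)%:E) + (Z w ^+ 2)%:E)))%E).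
  apply: ge0_le_integral => //.
  - by move=> w _; rewrite lee_fin sqr_ge0.
  - apply/measurable_EFinP; apply: measurable_funX; apply: measurable_funB => //.
    exact: measurable_coef_estimate.
  - apply: measurable_funeM; apply/measurable_EFinP.
    apply: measurable_funD; last exact: measurable_funX.
    by apply: measurable_funD => //; exact: measurable_funX.
  move=> w _; rewrite -!EFinD -EFinM lee_fin split3.
  have := sqr_ge0 (S w - bias); have := sqr_ge0 (S w - Z w); have := sqr_ge0 (bias - Z w).
  nra.
have mS2 : measurable_fun setT (fun w => (S w ^+ 2)%:E).
  by apply/measurable_EFinP; exact: measurable_funX.
have mZ2 : measurable_fun setT (fun w => (Z w ^+ 2)%:E).
  by apply/measurable_EFinP; exact: measurable_funX.
have S20 w : (0 <= (S w ^+ 2)%:E)%E by rewrite lee_fin sqr_ge0.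
have Z20 w : (0 <= (Z w ^+ 2)%:E)%E by rewrite lee_fin sqr_ge0.
have B20 : (0 <= (bias ^+ 2)%:E)%E by rewrite lee_fin sqr_ge0.
have mSB : measurable_fun setT (fun w => ((S w ^+ 2)%:E + (bias ^+ 2)%:E)%E).
  exact: emeasurable_funD.
rewrite ge0_integralZl//; last 2 first.
- exact: emeasurable_funD.
- by move=> w _; rewrite !adde_ge0.
rewrite ge0_integralD//; last by move=> w _; rewrite adde_ge0.
rewrite ge0_integralD// integral_probability_cst -/(Z _).
rewrite /coef_mse_bound [leRHS]EFinM; apply: lee_wpmul2l; first by rewrite lee_fin.
rewrite -/h [leRHS]EFinD; apply: leeD => //.
by rewrite addeC [leRHS]EFinD leeD// lee_fin.
Qed.

End coefficient_risk.

Section total_risk.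
Context (R : realType) (A : nat) (B : cdv_basis R A).
Context d (T : measurableType d) (P : probability T R).
Context (m : nat) (n : 'I_m -> nat) (L : nat).
Variables (X xi : obs n -> {RV P >-> R}) (W : 'I_m -> coefs B L -> {RV P >-> R}).
Variables (alpha rad : R) (p q : \bar R).
Hypothesis hp : (2%:E <= p)%E.
Hypothesis hq : (1%:E <= q)%E.
Hypothesis halpha : 2^-1 < alpha - einv p.
Variables (f : R -> R) (K s : R) (eps delta : 'I_m -> R).
Hypothesis hf : besov_ball B alpha p q rad f.
Local Notation I01 := (@unit_itv R).
Local Notation lebesgue := (@lebesgue_measure R).
Local Notation tau := (K + s).
Hypothesis K0 : 0 < K.
Hypothesis s0 : 0 < s.
Hypothesis fK : {ae lebesgue, forall x : R, I01 x -> `|f x| <= K}.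
Hypothesis mod : sampling_model tau eps delta X xi W.
Hypothesis m_gt0 : (0 < m)%N.
Hypothesis n_gt0 : forall j, (0 < n j)%N.
Hypothesis eps_gt0 : forall j, 0 < eps j.
Hypothesis delta01 : forall j, 0 < delta j <= 1.
Hypothesis lL : (lev0 B <= L)%N.

Lemma server_v_gt0 j : 0 < server_v n eps L j.
Proof.
by rewrite /server_v lt_min !mulr_gt0 ?exprn_gt0 ?ltr0n ?eps_gt0 ?n_gt0.
Qed.

Lemma sum_server_v_gt0 : 0 < \sum_j server_v n eps L j.
Proof.
rewrite (bigD1 (Ordinal m_gt0))//= ltr_pwDl ?server_v_gt0//.
by apply: sumr_ge0 => j _; rewrite ltW// server_v_gt0.
Qed.

Lemma risk_le : (risk tau eps X xi W f <=
  (rad ^+ 2 * (2 `^ (- (2 * alpha))) ^+ L +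
   ((nfather B + 2) * 2 ^ L)%:R *
   coef_mse_bound B n L K s eps delta (server_u n eps L))%:E)%E.
Proof.
have [f2 _] := hf.
pose u := server_u n eps L.
have u0 j : 0 < u j by rewrite divr_gt0 ?server_v_gt0 ?sum_server_v_gt0.
have u1 : \sum_j u j = 1.
  by rewrite /u /server_u -mulr_suml divff// gt_eqF// sum_server_v_gt0.
have sg0 j : 0 < noise_var B L tau (n j) (eps j) (delta j).
  by apply: noise_var_gt0 => //; exact: addr_gt0.
set E0 := rad ^+ 2 * _.
set b := coef_mse_bound B n L K s eps delta (server_u n eps L).
have mse c := coef_mse K0 s0 f2 fK mod n_gt0 u0 u1 sg0 c m_gt0.
have mest c := measurable_coef_estimate f2 mod u c.
pose Q c w := (coef_estimate X xi W f K s u c w - inner01 f (cwave c)) ^+ 2.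
have mQ c : measurable_fun setT (fun w => (Q c w)%:E).
  apply/measurable_EFinP; apply: measurable_funX; apply: measurable_funB => //.
have Q0 c w : (0 <= (Q c w)%:E)%E by rewrite lee_fin sqr_ge0.
set F2 := \int[lebesgue]_(y in I01) (f y ^+ 2) - energy B f L.+1.
have rE : risk tau eps X xi W f = (\int[P]_w (F2%:E + \sum_(c : coefs B L) (Q c w)%:E))%E.
  apply: eq_integral => w _; rewrite sumEFin -EFinD.
  by rewrite -(sq_dist01_coefs hf (fun c => coef_estimate X xi W f K s u c w)).
(* [F2] is the squared distance from [f] to its partial expansion; nonnegativity is needed to split
   the integral. *)
have F20 : 0 <= F2.
  have := sq_dist01_coefs hf (fun c : coefs B L => inner01 f (cwave c)).
  rewrite [X in _ + X]big1 ?addr0; last by move=> c _; rewrite subrr expr0n.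
  by rewrite -/F2 -lee_fin => <-; apply: integral_ge0 => y _; rewrite lee_fin sqr_ge0.
have FE : F2 <= E0 by exact: (approximation_error hp hq halpha hf lL).
have b0 : 0 <= b.
  rewrite /b /coef_mse_bound mulr_ge0// !addr_ge0//.
  - exact: sqr_ge0.
  - rewrite mulr_ge0 ?sqr_ge0//; apply: sumr_ge0 => j _.
    by rewrite divr_ge0 ?sqr_ge0.
  - apply: mulr_ge0; first by rewrite mulr_ge0 ?expR_ge0.
    by apply: sumr_ge0 => j _; apply: mulr_ge0; rewrite ?sqr_ge0// ltW.
have mQs : measurable_fun setT (fun w => \sum_(c : coefs B L) (Q c w)%:E)%E.
  by apply: emeasurable_sum.
rewrite rE ge0_integralD//; last first.
  by move=> w _; exact: sume_ge0.
rewrite integral_probability_cst ge0_integral_sum//.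
rewrite [leRHS]EFinD; apply: leeD.
  by rewrite lee_fin.
apply: (@le_trans _ _ (\sum_(c : coefs B L) b%:E)%E).
  by apply: lee_sum => c _; exact: mse.
rewrite sumEFin lee_fin sumr_const -[leLHS]mulr_natl ler_wpM2r// ler_nat.
exact: card_coefs.
Qed.

End total_risk.

(** * The choice of the resolution level *)

Lemma le_of_affine_le (R : realFieldType) (a l l' : R) : 0 <= a -> 0 <= l ->
  (2 * a + 2) * l <= l' + l -> l <= l'.
Proof.
move=> a0 l0; have : 0 <= a * l by exact: mulr_ge0.
rewrite mulrDl -mulrA; move: (a * l) => y; lra.
Qed.

Section resolution_level.
Context (R : realType) (A : nat) (B : cdv_basis R A) (d0 D : R).
Hypothesis d0_gt0 : 0 < d0.
Hypothesis d0D : d0 <= D.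

(* An upper bound for [2 ^+ L / D]: rounding up costs a factor 2, and the floor
   [(lev0 B).+1] on the level costs the second term, since [d0 <= D]. *)
Definition overshoot : R := Num.max 2 (2 ^+ (lev0 B).+1 / d0).

Let D_gt0 : 0 < D. Proof. exact: lt_le_trans d0D. Qed.
Let ln2_gt0 : 0 < ln 2 :> R. Proof. by rewrite ln_gt0// ltr1n. Qed.

Lemma expR_ln2 (x : R) : expR (x * ln 2) = 2 `^ x.
Proof. by rewrite /powR pnatr_eq0. Qed.

Lemma resolutionP : let L := resolution B D in
  [/\ (lev0 B < L)%N, D <= 2 ^+ L & 2 ^+ L <= overshoot * D].
Proof.
move=> L; set y := ln D / ln 2; set z := Num.max (lev0 B).+1%:Z (Num.ceil y).
have lz : (lev0 B).+1%:Z <= z by rewrite le_max lexx.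
(* The maximum is at least lev0 + 1, so the absolute value in [resolution] changes nothing. *)
have LE : L%:Z = z.
  by rewrite /L /resolution -/z gez0_abs// (le_trans _ lz).
have LR : L%:R = z%:~R :> R by rewrite -LE.
have D2 : D = 2 `^ y.
  by rewrite -expR_ln2 /y divfK ?gt_eqF// lnK ?posrE.
split.
- by rewrite -ltz_nat LE (lt_le_trans _ lz)// ltz_nat.
- rewrite [leLHS]D2 -powR_mulrn// ler_powR ?ler1n// LR.
  by rewrite (le_trans (ceil_ge y))// ler_int le_max lexx orbT.
have [h|h] := leP (Num.ceil y) (lev0 B).+1%:Z.
  have -> : L = (lev0 B).+1 by apply/eqP; rewrite -eqz_nat LE /z max_l.
  apply: (@le_trans _ _ (2 ^+ (lev0 B).+1 / d0 * D)).
    by rewrite mulrAC ler_pdivlMr// ler_wpM2l ?exprn_ge0.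
  by rewrite ler_wpM2r ?(ltW D_gt0)// le_max lexx orbT.
apply: (@le_trans _ _ (2 * D)); last by rewrite ler_wpM2r ?(ltW D_gt0)// le_max lexx.
rewrite [in leRHS]D2 -[X in X * _](powRr1 (ler0n R 2)) -powRD ?pnatr_eq0 ?implybT//.
rewrite -powR_mulrn// ler_powR ?ler1n// LR /z max_r ?ltW//.
have := ceilB1_lt y; rewrite rmorphB/= => hh; lra.
Qed.

Lemma overshoot_ge2 : 2 <= overshoot.
Proof. by rewrite le_max lexx. Qed.

(** D^(2 alpha + 1) <= N forces ln D <= ln N, and 2^L exceeds D by at most the factor [overshoot].
    As ln N >= ln 2, the logarithm of that factor is absorbed into a multiple of ln N. *)
Lemma resolution_le_ln (alpha : R) (N : nat) : 0 <= alpha -> (2 <= N)%N ->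
  D `^ (2 * alpha + 2) <= N%:R * D ->
  (resolution B D)%:R <= (ln overshoot / ln 2 + 1) / ln 2 * ln N%:R :> R.
Proof.
move=> a0 N2 DN; have [_ _ LD] := resolutionP.
set L := resolution B D in LD *.
have k2 := overshoot_ge2; have k0 : 0 < overshoot by apply: lt_le_trans k2.
have N0 : 0 < N%:R :> R by rewrite ltr0n ltnW.
have lN2 : ln 2 <= ln N%:R :> R by rewrite ler_ln ?posrE// ler_nat.
have lk : 0 <= ln overshoot by rewrite ln_ge0// (le_trans _ k2)// ler1n.
have lD : ln D <= ln N%:R.
  have : (2 * alpha + 2) * ln D <= ln N%:R + ln D.
    rewrite -ln_powR -lnM ?posrE// ler_ln ?posrE ?powR_gt0// mulr_gt0//.
  have [lD0|lD0] := lerP (ln D) 0; first by move=> _; rewrite (le_trans lD0)// (le_trans (ltW ln2_gt0)).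
  exact: (le_of_affine_le a0 (ltW lD0)).
have lL : L%:R * ln 2 <= ln overshoot + ln D.
  by rewrite -lnM ?posrE// -[X in X <= _]expRK expR_ln2 powR_mulrn// ler_ln ?posrE ?exprn_gt0// mulr_gt0.
rewrite mulrAC ler_pdivlMr//; apply: (le_trans lL).
rewrite mulrDl mul1r lerD// mulrAC ler_pdivlMr// ler_wpM2l//.
Qed.

End resolution_level.

(** * Size of the error terms at the chosen level and threshold *)

Section rate.
Context (R : realType) (A : nat) (B : cdv_basis R A).
Context (m : nat) (n : 'I_m -> nat) (L : nat).
Variables (alpha K : R) (eps delta : 'I_m -> R).
Hypothesis m_gt0 : (0 < m)%N.
Hypothesis n_gt0 : forall j, (0 < n j)%N.
Hypothesis eps_gt0 : forall j, 0 < eps j.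
Hypothesis delta01 : forall j, 0 < delta j <= 1.
Hypothesis alpha_gt0 : 0 < alpha.
Hypothesis L_gt0 : (0 < L)%N.

Let s : R := Num.sqrt ((2 * alpha + 1) * L%:R).
Local Notation tau := (K + s).

(** Starting from 1 does not alter the minimum, since there is a server and every delta is at most
    1. *)
Definition delta_min : R := \big[Num.min/1]_(j < m) delta j.

Lemma delta_min_gt0 : 0 < delta_min.
Proof.
rewrite /delta_min; elim/big_ind: _ => // [x y x0 y0|j _]; first by rewrite lt_min x0.
by case/andP: (delta01 j).
Qed.

Lemma delta_min_le j : delta_min <= delta j.
Proof. by rewrite /delta_min (bigD1 j)//= ge_min lexx. Qed.

Definition log_delta : R := ln (2 / delta_min).

Lemma log_delta_ge j : ln (2 / delta j) <= log_delta.
Proof.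
have dm := delta_min_gt0; case/andP: (delta01 j) => d0 _.
rewrite ler_ln ?posrE ?divr_gt0// ler_pM2l// lef_pV2 ?posrE//.
exact: delta_min_le.
Qed.

Lemma log_delta_ge_ln2 : ln 2 <= log_delta.
Proof.
apply: le_trans (log_delta_ge (Ordinal m_gt0)).
case/andP: (delta01 (Ordinal m_gt0)) => d0 d1.
rewrite ler_ln ?posrE ?divr_gt0// ler_pdivlMr// ler_piMr//.
Qed.

Let ln2_gt0 : 0 < ln 2 :> R. Proof. by rewrite ln_gt0// ltr1n. Qed.

Let s2 : s ^+ 2 = (2 * alpha + 1) * L%:R.
Proof. by rewrite sqr_sqrtr// mulr_ge0// addr_ge0// mulr_ge0// ltW. Qed.

Let L1 : 1 <= L%:R :> R. Proof. by rewrite ler1n. Qed.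

Let s2_ge1 : 1 <= s ^+ 2.
Proof. by rewrite s2; have := L1; move: alpha_gt0; nra. Qed.

Let s_gt0 : 0 < s.
Proof.
rewrite lt_neqAle sqrtr_ge0 andbT eq_sym.
by apply: contraL s2_ge1 => /eqP ->; rewrite expr0n/= -ltNge ltr01.
Qed.

Lemma threshold_sqr : tau ^+ 2 <= 2 * (K ^+ 2 + (2 * alpha + 1)) * L%:R.
Proof.
apply: (@le_trans _ _ (2 * (K ^+ 2 + s ^+ 2))).
  have := sqr_ge0 (K - s); nra.
rewrite s2 -mulrA ler_pM2l// [leRHS]mulrDl lerD2r ler_peMr ?sqr_ge0//.
Qed.

(** This explains the 2 alpha + 1 in the threshold: as ln 2 <= 1, exp(-s^2) <= 2^(-(2 alpha + 1) L),
    and the factor 2^L from the number of coefficients uses up one power. The 4 is that of (2/s)^2,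
    where s^2 >= 1. *)
Lemma truncation_bias : 2 ^+ L * (2 / s * expR (- (s ^+ 2 / 2))) ^+ 2 <=
  4 * (2 `^ (- (2 * alpha))) ^+ L.
Proof.
have -> : (2 / s * expR (- (s ^+ 2 / 2))) ^+ 2 = 4 * (s ^+ 2)^-1 * expR (- s ^+ 2).
  rewrite !exprMn exprVn [expR _ ^+ 2]expr2 -expRD -opprD -splitr; congr (_ * _ * _).
  ring.
have h1 : (s ^+ 2)^-1 <= 1 by rewrite invf_le1// (lt_le_trans _ s2_ge1).
have h2 : 2 ^+ L * expR (- s ^+ 2) <= (2 `^ (- (2 * alpha))) ^+ L.
  have -> : (2 `^ (- (2 * alpha))) ^+ L = 2 ^+ L * expR (- s ^+ 2 * ln 2).
    have -> : (2 `^ (- (2 * alpha))) ^+ L = 2 `^ (- (2 * alpha) * L%:R).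
      by rewrite -powR_mulrn ?powR_ge0// -powRrM.
    have -> : 2 ^+ L = 2 `^ L%:R :> R by rewrite powR_mulrn.
    rewrite s2 expR_ln2 -powRD ?pnatr_eq0 ?implybT//.
    by congr powR; ring.
  rewrite ler_pM2l ?exprn_gt0// ler_expR mulNr lerN2 ler_piMr ?sqr_ge0//.
  by rewrite -[leRHS](expRK 1) ler_ln ?posrE ?expR_gt0// (le_trans _ (expR_ge1Dx 1)).
have -> : 2 ^+ L * (4 * (s ^+ 2)^-1 * expR (- s ^+ 2)) =
    4 * ((s ^+ 2)^-1 * (2 ^+ L * expR (- s ^+ 2))) by ring.
rewrite ler_pM2l//; apply: le_trans h2; rewrite ler_piMl// mulr_ge0 ?expR_ge0//.
Qed.

Let v := server_v n eps L.
Let V := \sum_j v j.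

Let v_gt0 j : 0 < v j. Proof. exact: server_v_gt0. Qed.
Let V_gt0 : 0 < V. Proof. exact: sum_server_v_gt0. Qed.

Let sum_u : \sum_j server_u n eps L j = 1.
Proof. by rewrite /server_u -mulr_suml divff// gt_eqF. Qed.

Let u_ge0 j : 0 <= server_u n eps L j.
Proof. by rewrite /server_u divr_ge0 ?ltW// v_gt0. Qed.

(** v_j <= n_j 2^L turns u_j / n_j into at most 2^L / V; the remaining factors u_j sum to 1. *)
Lemma variance_bound :
  \sum_j server_u n eps L j ^+ 2 / (n j)%:R <= 2 ^+ L / V.
Proof.
rewrite (_ : 2 ^+ L / V = (\sum_j server_u n eps L j) * (2 ^+ L / V)); last first.
  by rewrite sum_u mul1r.
rewrite mulr_suml; apply: ler_sum => j _.
have nj : 0 < (n j)%:R :> R by rewrite ltr0n.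
rewrite expr2 -mulrA ler_wpM2l// /server_u -/V mulrAC ler_wpM2r ?invr_ge0 ?(ltW V_gt0)//.
by rewrite ler_pdivrMr// mulrC ge_min lexx orbT.
Qed.

(** The other side of the minimum, v_j <= n_j^2 eps_j^2, cancels the denominator of the noise
    variance. *)
Lemma noise_bound :
  \sum_j server_u n eps L j ^+ 2 * noise_var B L tau (n j) (eps j) (delta j) <=
  4 * tau ^+ 2 * c_psi B ^+ 2 * log_delta * (2 ^+ L / V).
Proof.
rewrite -[leRHS]mul1r -[X in X * (4 * _ * _ * _ * _)]sum_u mulr_suml.
apply: ler_sum => j _.
have nj : 0 < (n j)%:R :> R by rewrite ltr0n.
have ne : 0 < (n j)%:R ^+ 2 * eps j ^+ 2 by rewrite mulr_gt0 ?exprn_gt0.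
rewrite expr2 -mulrA ler_wpM2l//.
have -> : server_u n eps L j * noise_var B L tau (n j) (eps j) (delta j) =
    v j / ((n j)%:R ^+ 2 * eps j ^+ 2) *
    (4 * tau ^+ 2 * c_psi B ^+ 2 * (2 ^+ L / V) * ln (2 / delta j)).
  rewrite /server_u -/V -/(v j) /noise_var; ring.
rewrite [leRHS]mulrAC; set c := 4 * _ * _ * _.
have c0 : 0 <= c.
  apply: mulr_ge0; last by rewrite divr_ge0 ?exprn_ge0 ?(ltW V_gt0).
  apply: mulr_ge0; last exact: sqr_ge0.
  by apply: mulr_ge0; rewrite ?sqr_ge0.
have l0 : 0 <= ln (2 / delta j).
  case/andP: (delta01 j) => dj dj1.
  by rewrite ln_ge0// ler_pdivlMr// mul1r (le_trans dj1)// ler1n.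
apply: (@le_trans _ _ (c * ln (2 / delta j))).
  apply: ler_piMl; first exact: (mulr_ge0 c0 l0).
  by rewrite ler_pdivrMr// mul1r ge_min lexx.
by rewrite ler_wpM2l// log_delta_ge.
Qed.

Variables (D k : R).
Hypothesis D_gt0 : 0 < D.
Hypothesis DL : D <= 2 ^+ L.
Hypothesis kL : 2 ^+ L <= k * D.
Hypothesis k_ge2 : 2 <= k.
Hypothesis DE : D `^ (2 * alpha + 2) =
  \sum_(j < m) Num.min ((n j)%:R ^+ 2 * eps j ^+ 2) ((n j)%:R * D).

Let rho : R := (2 `^ (- (2 * alpha))) ^+ L.

Let rho_ge0 : 0 <= rho. Proof. by rewrite exprn_ge0// powR_ge0. Qed.

(** As D <= 2^L, each v_j dominates its counterpart in the equation for D, so V >= D^(2 alpha + 2).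
    Moreover 2^(2L) is 2^(L (2 alpha + 2)) rho, and 2^L <= k D. *)
Lemma weight_rate : 2 ^+ L * (2 ^+ L / V) <= k `^ (2 * alpha + 2) * rho.
Proof.
rewrite mulrA ler_pdivrMr//.
have DV : D `^ (2 * alpha + 2) <= V.
  rewrite DE; apply: ler_sum => j _; rewrite /v /server_v le_min !ge_min lexx/=.
  by rewrite ler_wpM2l// orbT.
have k0 : 0 <= k by apply: le_trans k_ge2.
have -> : 2 ^+ L * 2 ^+ L = (2 ^+ L) `^ (2 * alpha + 2) * rho.
  rewrite /rho -!powR_mulrn ?powR_ge0// -!powRrM -!powRD ?pnatr_eq0 ?implybT//.
  by congr powR; ring.
rewrite [leRHS]mulrAC ler_wpM2r//.
apply: (@le_trans _ _ ((k * D) `^ (2 * alpha + 2))).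
  apply: ge0_ler_powR; rewrite ?nnegrE ?exprn_ge0 ?mulr_ge0 ?(ltW D_gt0)//.
  by move: alpha_gt0; lra.
by rewrite powRM ?(ltW D_gt0)// ler_wpM2l ?powR_ge0.
Qed.

Lemma coef_mse_rate :
  2 ^+ L * coef_mse_bound B n L K s eps delta (server_u n eps L) <=
  3 * rho * (4 + k `^ (2 * alpha + 2) * (2 * (K ^+ 2 + (2 * alpha + 1)) * L%:R) *
    (1 + 32 * expR 2^-1 * c_psi B ^+ 2 * log_delta)).
Proof.
have hb := truncation_bias; have hw := weight_rate; have ht := threshold_sqr.
have hv := variance_bound; have hn := noise_bound.
have P0 : 0 <= 2 ^+ L :> R by exact: exprn_ge0.
have ll : 0 <= log_delta by rewrite (le_trans _ log_delta_ge_ln2)// ltW.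
rewrite /coef_mse_bound mulrCA -[leRHS]mulrA ler_pM2l//.
rewrite [leLHS]mulrDr [X in X + _ <= _]mulrDr.
rewrite -/rho in hb.
set Y := 2 ^+ L / V in hw hv hn.
set kk := k `^ _ in hw *.
set t2 := tau ^+ 2 in ht hn *.
set tL := 2 * (K ^+ 2 + _) * _ in ht *.
set g := expR 2^-1; have g0 : 0 <= g by exact: expR_ge0.
set cp := c_psi B ^+ 2 in hn *; have cp0 : 0 <= cp by exact: sqr_ge0.
have t20 : 0 <= t2 by exact: sqr_ge0.
have kk0 : 0 <= kk by exact: powR_ge0.
have Y0 : 0 <= 2 ^+ L * Y by apply: mulr_ge0 => //; rewrite divr_ge0// ltW.
have g8 : 0 <= 8 * g by apply: mulr_ge0.
have f0 : 0 <= 32 * g * cp * log_delta.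
  apply: mulr_ge0 => //; apply: mulr_ge0 => //; exact: mulr_ge0.
have a1 : 2 ^+ L * (t2 * \sum_j server_u n eps L j ^+ 2 / (n j)%:R) <= tL * (kk * rho).
  apply: (@le_trans _ _ (t2 * (2 ^+ L * Y))).
    by rewrite mulrCA ler_wpM2l// ler_wpM2l.
  exact: ler_pM.
have a2 : 2 ^+ L * (8 * g * \sum_j server_u n eps L j ^+ 2 *
      noise_var B L tau (n j) (eps j) (delta j)) <=
    32 * g * cp * log_delta * (tL * (kk * rho)).
  apply: (@le_trans _ _ (2 ^+ L * (8 * g * (4 * t2 * cp * log_delta * Y)))).
    by rewrite (ler_wpM2l P0)// (ler_wpM2l g8).
  have -> : 2 ^+ L * (8 * g * (4 * t2 * cp * log_delta * Y)) =
      32 * g * cp * log_delta * (t2 * (2 ^+ L * Y)) by ring.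
  rewrite (ler_wpM2l f0)//; exact: ler_pM.
apply: le_trans (lerD (lerD hb a1) a2) _.
by rewrite le_eqVlt; apply/orP; left; apply/eqP; ring.
Qed.

End rate.

(** The privacy half carries two premises. [c_psi] records only the mother wavelet, so the father
    and boundary wavelets have to be bounded by it as well; and the Chernoff bound for the given
    noise scale works in the regime eps <= 2 ln(2/delta). *)
Theorem theorem3p2 (R : realType) (A : nat) (B : cdv_basis R A)
    (alpha : R) (p q : \bar R) (rad Cinf Ceps d0 : R)
    (hp : (2%:E <= p)%E) (hq : (1%:E <= q)%E)
    (halpha : 2^-1 < alpha - einv p) (hA : alpha < A%:R)
    (hrad : 0 < rad) (hCinf : 0 < Cinf)
    (hsup : forall f : R -> R, besov_ball B alpha p q rad f ->
       {ae lebesgue_measure, forall x : R, unit_itv x -> `|f x| <= Cinf})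
    (hd0 : 0 < d0) :
  exists C : R, 0 < C /\
  forall (m : nat) (n : 'I_m -> nat) (eps delta : 'I_m -> R) (D tau : R)
    (N L : nat),
    N = (\sum_(j < m) n j)%N ->
    (2 <= N)%N ->
    (forall j, (0 < n j)%N) ->
    (forall j, 0 < eps j <= Ceps) ->
    (forall j, 0 < delta j <= 1) ->
    d0 <= D ->
    D `^ (2 * alpha + 2) =
      \sum_(j < m) Num.min ((n j)%:R ^+ 2 * eps j ^+ 2) ((n j)%:R * D) ->
    L = resolution B D ->
    tau = Cinf + Num.sqrt ((2 * alpha + 1) * L%:R) ->
  forall (d : measure_display) (Omega : measurableType d)
    (P : probability Omega R) (X xi : obs n -> {RV P >-> R})
    (W : 'I_m -> coefs B L -> {RV P >-> R}),
    sampling_model tau eps delta X xi W ->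
    (forall j,
       (forall l k x, (k < nwave B l)%N -> unit_itv x ->
          `|wave B l k x| <= 2 `^ (l%:R / 2) * mother_sup B) ->
       eps j <= 2 * ln (2 / delta j) ->
       diff_private (eps j) (delta j) (transcript_law (k := n j) tau (W j)))
    /\
    (ereal_sup [set risk tau eps X xi W f | f in besov_ball B alpha p q rad]
       <= (C * ln N%:R * 2 `^ (- (2 * L%:R * alpha))
             * ln (2 / \big[Num.min/1]_(j < m) delta j))%:E)%E.
Proof.
have ep := einv_ge0 hp.
have alpha_gt0 : 0 < alpha by lra.
have ln2_gt0 : 0 < ln 2 :> R by rewrite ln_gt0// ltr1n.
pose k := overshoot B d0; have k2 : 2 <= k := overshoot_ge2 B d0.
pose b : R := (nfather B + 2)%:R * 3.
pose c1 := 2 * (Cinf ^+ 2 + (2 * alpha + 1)).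
pose c2 := (ln k / ln 2 + 1) / ln 2.
pose g := 32 * expR 2^-1 * c_psi B ^+ 2.
pose kk := k `^ (2 * alpha + 2).
(* ln N and ln(2/delta') are both at least ln 2, so [e2] times their product is at least 1; it pads
   the terms that lack a logarithm. *)
pose e2 := ln 2 ^- 2 : R.
have b0 : 0 <= b by rewrite mulr_ge0.
have c10 : 0 <= c1 by rewrite mulr_ge0// addr_ge0 ?sqr_ge0//; lra.
have g0 : 0 <= g by rewrite mulr_ge0 ?sqr_ge0// mulr_ge0 ?expR_ge0.
have kk0 : 0 <= kk by exact: powR_ge0.
have e20 : 0 < e2 by rewrite invr_gt0 exprn_gt0.
have c20 : 0 <= c2.
  rewrite divr_ge0 ?(ltW ln2_gt0)// addr_ge0// divr_ge0 ?(ltW ln2_gt0)// ln_ge0//.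
  by rewrite (le_trans _ k2)// ler1n.
(* The first summand pays for the levels above L, [4 * e2] for the truncation bias, and the rest for
   the two variances. *)
pose C := rad ^+ 2 * e2 + b * (4 * e2 + kk * (c1 * (c2 * ((ln 2)^-1 + g)))).
have C0 : 0 < C.
  apply: ltr_pwDl; first by rewrite mulr_gt0// exprn_gt0.
  have i0 : 0 <= (ln 2)^-1 :> R by rewrite invr_ge0 ltW.
  apply: mulr_ge0 => //; apply: addr_ge0; first by apply: mulr_ge0 => //; exact: ltW.
  do 3 apply: mulr_ge0 => //; exact: addr_ge0.
exists C; split => // m n eps delta D tau N L NE N2 n0 eps0 delta01 d0D DE LE tauE.
move=> d Omega P X xi W mod.
(* N >= 2 excludes an empty set of servers. *)
have m0 : (0 < m)%N.
  rewrite lt0n; apply/eqP => mE; move: N2; rewrite NE big1// => j _.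
  by have := ltn_ord j; rewrite {2}mE.
have [] := resolutionP B hd0 d0D; rewrite -LE -/k => lL DL kL.
have L0 : (0 < L)%N by apply: leq_ltn_trans lL.
have eps_gt0 j : 0 < eps j by case/andP: (eps0 j).
have s_gt0 : 0 < Num.sqrt ((2 * alpha + 1) * L%:R).
  by rewrite sqrtr_gt0 mulr_gt0 ?ltr0n//; lra.
subst tau; split.
  move=> j wave_le el.
  apply: (transcript_diff_private wave_le _ (n0 j) (eps_gt0 j) (delta01 j) el
    (fun c => noise_law mod j c)).
    exact: addr_gt0.
  exact: (independent_noise_server (sources_independent mod) j).
apply: ge_ereal_sup => _ [f hf <-].
have D_gt0 : 0 < D by apply: lt_le_trans d0D.
have fK := hsup _ hf.
apply: (le_trans (risk_le hp hq halpha hf hCinf s_gt0 fK mod m0 n0 eps_gt0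
  delta01 (ltnW lL))).
rewrite lee_fin.
have hr := coef_mse_rate B Cinf m0 n0 eps_gt0 delta01 alpha_gt0 L0 D_gt0 DL kL k2 DE.
rewrite -/(delta_min delta) -/(log_delta delta).
have -> : 2 `^ (- (2 * L%:R * alpha)) = (2 `^ (- (2 * alpha))) ^+ L :> R.
  by rewrite -powR_mulrn ?powR_ge0// -powRrM; congr powR; ring.
set rho := (2 `^ (- (2 * alpha))) ^+ L in hr *.
have rho0 : 0 <= rho by rewrite exprn_ge0// powR_ge0.
(* Each minimum in the equation for D is at most n_j D, so D^(2 alpha + 2) <= N D. *)
have hL : L%:R <= c2 * ln N%:R.
  rewrite LE; apply: (resolution_le_ln B hd0 d0D (ltW alpha_gt0) N2).
  rewrite DE NE natr_sum mulr_suml; apply: ler_sum => j _.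
  by rewrite ge_min lexx orbT.
have hlam := log_delta_ge_ln2 m0 delta01.
have hN : ln 2 <= ln N%:R :> R by rewrite ler_ln ?posrE ?ltr0n ?ler_nat// ltnW.
set lam := log_delta delta in hlam hr *.
set lN := ln N%:R in hN hL *.
rewrite natrM natrX -[_ * coef_mse_bound _ _ _ _ _ _ _ _]mulrA.
have q1 : 1 <= e2 * (lN * lam).
  by rewrite /e2 mulrC ler_pdivlMr ?exprn_gt0// mul1r expr2 ler_pM// ltW.
have lN0 : 0 <= lN by rewrite (le_trans (ltW ln2_gt0)).
have lam0 : 0 <= lam by rewrite (le_trans (ltW ln2_gt0)).
(* [L] supplies the factor ln N, and the 1 is absorbed into [lam] because lam >= ln 2. *)
have q2 : L%:R * (1 + g * lam) <= c2 * ((ln 2)^-1 + g) * (lN * lam).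
  have h1 : 1 + g * lam <= ((ln 2)^-1 + g) * lam.
    by rewrite mulrDl lerD2r mulrC ler_pdivlMr// mul1r.
  apply: (@le_trans _ _ ((c2 * lN) * (((ln 2)^-1 + g) * lam))); last first.
    by rewrite le_eqVlt; apply/orP; left; apply/eqP; ring.
  by apply: ler_pM => //; rewrite addr_ge0// mulr_ge0.
have step : (nfather B + 2)%:R *
    (2 ^+ L * coef_mse_bound B n L Cinf (Num.sqrt ((2 * alpha + 1) * L%:R)) eps
      delta (server_u n eps L)) <=
    b * (4 * e2 + kk * (c1 * (c2 * ((ln 2)^-1 + g)))) * (lN * lam) * rho.
  apply: (@le_trans _ _ (b * (rho * (4 + kk * (c1 * (L%:R * (1 + g * lam))))))).
    rewrite /b -mulrA ler_wpM2l//; apply: (le_trans hr).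
    by rewrite le_eqVlt; apply/orP; left; apply/eqP; rewrite /kk /c1 /g; ring.
  rewrite -[leRHS]mulrA -[leRHS]mulrA ler_wpM2l// [leRHS]mulrA.
  rewrite [leRHS]mulrC ler_wpM2l// mulrDl; apply: lerD.
    by rewrite -[leLHS]mulr1 -mulrA ler_wpM2l.
  by rewrite -[leRHS]mulrA ler_wpM2l// -[leRHS]mulrA ler_wpM2l.
have step0 : rad ^+ 2 * rho <= rad ^+ 2 * e2 * (lN * lam) * rho.
  by rewrite ler_wpM2r// -mulrA ler_peMr ?sqr_ge0.
apply: le_trans (lerD step0 step) _.
by rewrite /C le_eqVlt; apply/orP; left; apply/eqP; ring.
Qed.
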